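(* Let $\theta_\ast>0$ and $\sigma>0$ be fixed, and let $c = 8\log(4\theta_\ast/\sigma^2)$. Consider the Poisson mixture model in which $X_1,\dots,X_n$ are i.i.d. with probability mass function $$h_Q^{\rm Pois}(x)=\int_0^{\theta_\ast}\frac{e^{-\theta}\theta^x}{x!}\,\mathrm{d}Q(\theta),\qquad x\in\{0,1,2,\dots\},$$ where $Q$ is an unknown probability measure on $[0,\theta_\ast]$. Let $\hat Q_{\rm MLE}$ be the nonparametric maximum likelihood estimator $$\hat Q_{\rm MLE}\in\operatorname*{argmax}_{\tilde Q\in\mathcal P([0,\theta_\ast])}\sum_{i=1}^n\log h^{\rm Pois}_{\tilde Q}(X_i).$$ Then, as $n\to\infty$, $$\sup_{Q\in\mathcal P([0,\theta_\ast])}\mathbb E\,W_1^\sigma(Q,\hat Q_{\rm MLE})=\begin{cases} O\big(n^{-1/2+c/\log\log n}\,\mathrm{Polylog}(n)\big), & \text{if } \sigma^2<4\theta_\ast,\\ O\big(n^{-1/2}\,\mathrm{Polylog}(n)\big), & \text{if } \sigma^2\ge 4\theta_\ast.\end{cases}$$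
   Context: $\mathcal P([0,\theta_\ast])$ denotes the set of all probability measures on $[0,\theta_\ast]$. $W_1$ denotes the Wasserstein-1 distance between probability measures on $\mathbb R$. For fixed $\sigma>0$, the Gaussian-smoothed optimal transport (GOT) distance is $W_1^\sigma(Q,Q')=W_1\big(Q\ast\mathcal N(0,\sigma^2),\,Q'\ast\mathcal N(0,\sigma^2)\big)$, where $\ast$ denotes convolution of measures. The expectation is over $X_1,\dots,X_n$ i.i.d. from $h_Q^{\rm Pois}$. The $O(\cdot)$ constants may depend on $\theta_\ast$ and $\sigma^2$ but not on $n$ or $Q$, and $\mathrm{Polylog}(n)$ denotes a factor of the form $(\log n)^{a}$ for some constant $a>0$ not depending on $n$. *)

(* Defs.v *)
From HB Require Import structures.
From mathcomp Require Import all_boot all_order all_algebra.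
From mathcomp Require Import all_classical all_reals all_analysis.
Set Implicit Arguments. Unset Strict Implicit. Unset Printing Implicit Defensive.
Import Order.TTheory GRing.Theory Num.Def Num.Theory.
Local Open Scope classical_set_scope.
Local Open Scope ring_scope.

Section defs.
Context {R : realType}.

Definition I0 (th : R) : set R := `[0, th]%classic.

Definition supported_on (th : R) (Q : probability R R) : Prop :=
  Q (I0 th) = 1%E.

(** Poisson pmf, with the convention 0^0 = 1 (so rate 0 gives the Dirac mass at 0). *)
Definition pois (theta : R) (x : nat) : R :=
  expR (- theta) * theta ^+ x / (x`!)%:R.

Definition hpois (th : R) (Q : probability R R) (x : nat) : R :=
  fine (\int[Q]_(t in I0 th) (pois t x)%:E)%E.

Definition likelihood (th : R) n (Q : probability R R) (X : 'I_n -> nat) : R :=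
  \prod_(i < n) hpois th Q (X i).

Definition gauss_conv (s : R) (Q : probability R R) (A : set R) : \bar R :=
  (\int[Q]_t normal_prob t s A)%E.

Definition is_coupling (mu nu : set R -> \bar R) (pi : probability (R * R)%type R)
  : Prop :=
  forall A : set R, measurable A ->
    pi (A `*` setT) = mu A /\ pi (setT `*` A) = nu A.

Definition W1 (mu nu : set R -> \bar R) : \bar R :=
  ereal_inf [set (\int[pi]_z (`|z.1 - z.2|)%:E)%E
            | pi in [set pi | is_coupling mu nu pi]].

Definition W1s (s : R) (Q Q' : probability R R) : \bar R :=
  W1 (gauss_conv s Q) (gauss_conv s Q').

Definition is_NPMLE (th : R) (Qhat : forall n, ('I_n -> nat) -> probability R R)
  : Prop :=
  forall n (X : 'I_n -> nat),
    supported_on th (Qhat n X) /\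
    forall Q : probability R R, supported_on th Q ->
      likelihood th Q X <= likelihood th (Qhat n X) X.

Definition risk (th s : R) (Qhat : forall n, ('I_n -> nat) -> probability R R)
  (n : nat) (Q : probability R R) : \bar R :=
  (\esum_(X in [set: 'I_n -> nat]) (likelihood th Q X)%:E * W1s s Q (Qhat n X))%E.

End defs.

(* Main.v *)
(** The smoothed distance is at most the integral of [|x| |p - q|] over the two smoothed densities, by
    the coupling that keeps their common mass fixed. Expanding the Gaussian kernel to order [M] turns
    [p - q] into a combination of differences of Poisson mixture probabilities with indices below
    [3 M] and coefficients of size [max 1 (2 sqrt th / s) ^ (3 M)], up to an error [B ^ M / sqrt (M!)].
    Those differences are controlled by the Hellinger distance of the mixtures, which for the maximum
    likelihood estimator is at most the chi-square distance of the empirical distribution to the truth,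
    of expectation [3 M / n] up to a tail. The choice [M ~ 4 ln n / ln (ln n)] balances the errors. *)

Require Import Defs.
From HB Require Import structures.
From mathcomp Require Import all_boot all_order all_algebra.
From mathcomp Require Import all_classical all_reals all_analysis.
From mathcomp Require Import measurable_realfun.
From mathcomp Require Import ring lra zify.
Import Order.TTheory GRing.Theory Num.Def Num.Theory.
Import numFieldNormedType.Exports HBNNSimple.
Local Open Scope classical_set_scope.
Local Open Scope ring_scope.
Set Implicit Arguments.
Unset Strict Implicit.
Unset Printing Implicit Defensive.

(** * Couplings and total variation *)

(** The threshold [s ^ 2 = 4 * th] comes from a cancellation of factorials. Writing [t ^ k] as
    [k! * expR t * pois t k] costs [k!], whereas the Hellinger distance controls a difference of
    probabilities at [k] with the gain [sqrt (th ^ k / k!)]. The surviving [sqrt k!] is paid by the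
    denominators of the two Taylor series, up to [2 ^ k] and a factor [expR (z ^ 2 / 4)] with
    [z = x / s + s], which the Gaussian decay in [x] absorbs. What remains is [(2 sqrt th / s) ^ k],
    harmless when the ratio is at most 1. Each cell costs about [1 / n] in the expected chi-square
    distance, so only the first [3 M] values enter it. Samples that leave this range are rare, and
    on them a constant bound on the smoothed distance is enough. *)

Section density_measure.
Context d (T : measurableType d) (R : realType).
Variables (mu : {measure set T -> \bar R}) (f : T -> R).
Hypotheses (mf : measurable_fun [set: T] f) (f_ge0 : forall x, 0 <= f x).
Local Open Scope ereal_scope.

(** The proofs are arguments so that the measure structure declared below can be inferred from the
    term [mdensity mf f_ge0]. *)
Definition mdensity (_ : measurable_fun [set: T] f) (_ : forall x, (0 <= f x)%R)
  (A : set T) : \bar R := \int[mu]_(x in A) (f x)%:E.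

Local Notation nu := (mdensity mf f_ge0).

Let nu0 : nu set0 = 0.
Proof. by rewrite /mdensity integral_set0. Qed.

Let nu_ge0 A : 0 <= nu A.
Proof. by apply: integral_ge0 => x _; rewrite lee_fin. Qed.

Let nu_sigma_additive : semi_sigma_additive nu.
Proof.
move=> /= F mF tF mUF; rewrite /mdensity ge0_integral_bigcup//=; last 2 first.
- by apply/measurable_EFinP; exact: measurable_funTS.
- by move=> x _; rewrite lee_fin.
by apply: is_cvg_ereal_nneg_natsum_cond => n _ _; exact: nu_ge0.
Qed.

HB.instance Definition _ := isMeasure.Build _ _ _ nu nu0 nu_ge0 nu_sigma_additive.

Lemma mdensityE A : measurable A -> nu A = \int[mu]_x (f x * \1_A x)%:E.
Proof.
move=> mA; rewrite /mdensity integral_mkcond; apply: eq_integral => x _.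
by rewrite patchE indicE; case: ifP => _; rewrite ?mulr1 ?mulr0.
Qed.

(** Linearity gives the identity for simple functions; monotone convergence on both sides along an
    increasing simple approximation of [g] extends it. *)
Lemma ge0_integral_mdensity (g : T -> \bar R) :
  measurable_fun [set: T] g -> (forall x, 0 <= g x) ->
  \int[nu]_x g x = \int[mu]_x (g x * (f x)%:E).
Proof.
move=> mg g0; pose h := nnsfun_approx measurableT mg.
have mh n : measurable_fun setT (h n) by [].
have hnd x : {homo (fun n => h n x) : n m / (n <= m)%N >-> (n <= m)%R}.
  by move=> n m nm; exact/lefP/nd_nnsfun_approx.
have cg x : EFin \o h ^~ x @ \oo --> g x by exact: cvg_nnsfun_approx.
transitivity (limn (fun n => \int[nu]_x (h n x)%:E)).
  rewrite -monotone_convergence//=; first last.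
  - by move=> x _ n m nm; rewrite lee_fin hnd.
  - by move=> n x _; rewrite lee_fin.
  - by move=> n; exact/measurable_EFinP.
  by apply: eq_integral => x _; apply/esym/cvg_lim => //; exact: cg.
transitivity (limn (fun n => \int[mu]_x ((h n x)%:E * (f x)%:E))); last first.
  rewrite -monotone_convergence//=; first last.
  - by move=> x _ n m nm; apply: lee_wpmul2r; rewrite lee_fin ?hnd.
  - by move=> n x _; rewrite mule_ge0 ?lee_fin.
  - by move=> n; apply: emeasurable_funM; exact/measurable_EFinP.
  apply: eq_integral => x _; apply/cvg_lim => //.
  exact: cvgeZr (cg x).
congr (limn _); apply/funext => n.
rewrite integralT_nnsfun sintegralE.
under [RHS]eq_integral => x _.
  rewrite fimfunE -fsumEFin// ge0_mule_fsuml; last first.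
    by move=> r; rewrite nnfun_muleindic_ge0.
  over.
rewrite ge0_integral_fsum//=; first last.
- move=> r x _; rewrite mule_ge0 ?lee_fin//; exact: nnfun_muleindic_ge0.
- by move=> r; apply: emeasurable_funM; apply/measurable_EFinP => //;
    apply: measurable_funM.
apply: eq_fsbigr => r; rewrite inE => -[x _ <-{r}].
have mA : measurable (h n @^-1` [set h n x]) by exact: measurable_sfunP.
rewrite mdensityE// -ge0_integralZl ?lee_fin//; last 2 first.
- by apply/measurable_EFinP/measurable_funM => //; exact: measurable_indic.
- by move=> y _; rewrite lee_fin mulr_ge0.
by apply: eq_integral => y _; rewrite -!EFinM; congr _%:E; ring.
Qed.

End density_measure.

Section coupling_cost.
Context (R : realType).
Variables (M : {measure set R -> \bar R}).
Variables (F G : {finite_measure set R -> \bar R}).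
Hypotheses (MF1 : (M setT + F setT = 1)%E) (FG : F setT = G setT).
Local Open Scope ereal_scope.

Let r : R := fine (F setT).
Let rE : F setT = r%:E. Proof. by rewrite fineK// fin_num_measure. Qed.
Let rGE : G setT = r%:E. Proof. by rewrite -FG. Qed.
Let r0 : (0 <= r)%R. Proof. by rewrite fine_ge0 ?measure_ge0. Qed.
Let ri0 : (0 <= r^-1)%R. Proof. by rewrite invr_ge0. Qed.

Let D (x : R) := (x, x).
Let mD : measurable_fun setT D. Proof. exact: measurable_fun_pair. Qed.

Let DM : {measure set (R * R) -> \bar R} :=
  ltac:(refine (pushforward M D : {measure set _ -> \bar R}); exact: mD).

(* [M] stays on the diagonal and the excess masses are coupled independently; if they vanish,
   [r^-1 = 0] removes the second term. *)
Let P : {measure set (R * R) -> \bar R} :=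
  measure_add DM (mscale (NngNum ri0) (F \x G)).

Let scaled (H : {finite_measure set R -> \bar R}) A :
  H setT = r%:E -> measurable A -> r^-1%:E * (H A * r%:E) = H A.
Proof.
move=> Hr mA.
have hA : H A \is a fin_num by rewrite fin_num_measure.
have hle : H A <= r%:E by rewrite -Hr le_measure ?inE.
rewrite -(fineK hA) -!EFinM; congr EFin.
have [r00|rn0] := eqVneq r 0%R; last by field.
by apply/eqP; rewrite r00 mulr0 mulr0 eq_sym eq_le -!lee_fin fineK// measure_ge0 andbT -r00.
Qed.

Let PE A : P A = M (D @^-1` A) + r^-1%:E * (F \x G) A.
Proof. by rewrite -[LHS]/(measure_add DM (mscale (NngNum ri0) (F \x G)) A) measure_addE. Qed.

Let P1 A : measurable A -> P (A `*` setT) = M A + F A.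
Proof.
move=> mA; rewrite PE product_measure1E//.
transitivity (M A + r^-1%:E * (F A * r%:E)); last by rewrite scaled.
congr (_ + _); last by congr (_ * (_ * _)).
by congr (M _); apply/seteqP; split=> [x []//|x Ax]; split.
Qed.

Let P2 A : measurable A -> P (setT `*` A) = M A + G A.
Proof.
move=> mA; rewrite PE product_measure1E//.
transitivity (M A + r^-1%:E * (G A * r%:E)); last by rewrite scaled.
congr (_ + _); last by congr (_ * _); rewrite muleC; congr (_ * _).
by congr (M _); apply/seteqP; split=> [x []//|x Ax]; split.
Qed.

Let PT : P setT = 1.
Proof. by rewrite -setXTT P1. Qed.

Let PP_exists : exists PP : probability (R * R)%type R,
  (PP : set _ -> \bar R) = (P : set _ -> \bar R).
Proof.
pose PP : probability (R * R)%type R :=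
  HB.pack (Measure.sort P) (Measure_isProbability.Build _ _ _ P PT).
by exists PP.
Qed.

Let mnorm : measurable_fun setT (fun x : R => `|x|%:E : \bar R).
Proof. by apply/measurable_EFinP; exact: normr_measurable. Qed.

(** The diagonal part of [P] costs nothing. Elsewhere [|x - y| <= |x| + |y|], and integrating over
    [F \x G] produces a factor [r] that the scaling by [r^-1] removes. *)
Lemma W1_le_split (mu nu : set R -> \bar R) :
  (forall A, measurable A -> mu A = M A + F A) ->
  (forall A, measurable A -> nu A = M A + G A) ->
  W1 mu nu <= \int[F]_x `|x|%:E + \int[G]_x `|x|%:E.
Proof.
move=> muE nuE.
have mdist : measurable_fun [set: R * R] (fun z : R * R => `|z.1 - z.2|%:E : \bar R).
  apply/measurable_EFinP; apply: measurableT_comp => //.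
  by apply: measurable_funB; [exact: measurable_fst|exact: measurable_snd].
apply: (@le_trans _ _ (\int[P]_z `|z.1 - z.2|%:E)).
  have [PP PPE] := PP_exists; apply: ereal_inf_lbound; exists PP.
    by move=> A mA; rewrite PPE P1// P2// muE// nuE.
  by apply: eq_measure_integral => A _ _; exact: (congr1 (fun f => f A) PPE).
rewrite ge0_integral_measure_add//.
rewrite ge0_integral_pushforward// preimage_setT.
under eq_integral do rewrite /= subrr normr0.
rewrite integral0 add0e ge0_integral_mscale// fubini_tonelli1//.
set SF := \int[F]_x _; set SG := \int[G]_x _.
have SF0 : 0 <= SF by apply: integral_ge0 => x _; rewrite lee_fin.
have SG0 : 0 <= SG by apply: integral_ge0 => x _; rewrite lee_fin.
have inner x : fubini_F G (fun z : R * R => `|z.1 - z.2|%:E) x <= `|x|%:E * r%:E + SG.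
  rewrite /fubini_F /= -rGE -[X in X + _]integral_cst// -ge0_integralD//; last by move=> y _; rewrite /= lee_fin.
  apply: ge0_le_integral => //.
  - exact: (measurableT_comp mdist (measurable_pair1 x)).
  - by apply: emeasurable_funD.
  - by move=> y _; rewrite /= -EFinD lee_fin ler_normB.
have bound : \int[F]_x fubini_F G (fun z : R * R => `|z.1 - z.2|%:E) x <= r%:E * (SF + SG).
  have -> : r%:E * (SF + SG) = \int[F]_x (`|x|%:E * r%:E + SG).
    rewrite ge0_integralD//; last 2 first.
    - by move=> x _; rewrite mule_ge0 ?lee_fin.
    - exact: emeasurable_funM.
    have -> : \int[F]_x (`|x|%:E * r%:E) = SF * r%:E by rewrite ge0_integralZr ?lee_fin.
    have -> : \int[F]__ SG = SG * r%:E by rewrite -rE; exact: integral_cst.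
    by rewrite ge0_muleDr// [r%:E * SF]muleC [r%:E * SG]muleC.
  apply: ge0_le_integral => //.
  - by move=> x _; apply: integral_ge0 => y _; rewrite lee_fin.
  - exact: measurable_fun_fubini_tonelli_F.
  - by apply: emeasurable_funD => //; exact: emeasurable_funM.
apply: (@le_trans _ _ (r^-1%:E * (r%:E * (SF + SG)))).
  by rewrite lee_wpmul2l ?lee_fin.
rewrite muleA -EFinM; have [->|r00] := eqVneq r 0%R.
  by rewrite mulr0 mul0e adde_ge0.
by rewrite mulVf// mul1e.
Qed.
End coupling_cost.

Section density_coupling.
Context (R : realType).
Variable mu : {measure set R -> \bar R}.
Variables (p q : R -> R).
Hypotheses (mp : measurable_fun setT p) (mq : measurable_fun setT q).
Hypotheses (p0 : forall x, 0 <= p x) (q0 : forall x, 0 <= q x).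
Hypotheses (p1 : (\int[mu]_x (p x)%:E = 1)%E) (q1 : (\int[mu]_x (q x)%:E = 1)%E).
Local Open Scope ereal_scope.

Let m x : R := minr (p x) (q x).
Let f x : R := (p x - m x)%R.
Let g x : R := (q x - m x)%R.
Let mm : measurable_fun setT m. Proof. exact: measurable_minr. Qed.
Let mf : measurable_fun setT f. Proof. exact: measurable_funB. Qed.
Let mg : measurable_fun setT g. Proof. exact: measurable_funB. Qed.
Let m0 x : (0 <= m x)%R. Proof. by rewrite le_min p0 q0. Qed.
Let f0 x : (0 <= f x)%R. Proof. by rewrite subr_ge0 ge_min lexx. Qed.
Let g0 x : (0 <= g x)%R. Proof. by rewrite subr_ge0 ge_min lexx orbT. Qed.
Let fg x : (f x + g x)%R = `|p x - q x|%R.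
Proof.
rewrite /f /g /m; case: (leP (p x) (q x)) => h; last by rewrite gtr0_norm; lra.
by rewrite ler0_norm; lra.
Qed.

Let M : {measure set R -> \bar R} := mdensity mu mm m0.
Let F : {measure set R -> \bar R} := mdensity mu mf f0.
Let G : {measure set R -> \bar R} := mdensity mu mg g0.

Let split_density (u v w : R -> R) (mv : measurable_fun setT v) (mw : measurable_fun setT w)
    (v0 : forall x, (0 <= v x)%R) (w0 : forall x, (0 <= w x)%R) A :
  (forall x, u x = v x + w x)%R -> measurable A ->
  \int[mu]_(x in A) (u x)%:E = mdensity mu mv v0 A + mdensity mu mw w0 A.
Proof.
move=> uvw mA; rewrite /mdensity -ge0_integralD//=; last 4 first.
- by move=> x _; rewrite lee_fin.
- by apply/measurable_EFinP; exact: measurable_funTS.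
- by move=> x _; rewrite lee_fin.
- by apply/measurable_EFinP; exact: measurable_funTS.
by apply: eq_integral => x _; rewrite -EFinD uvw.
Qed.

Let MF A : measurable A -> \int[mu]_(x in A) (p x)%:E = M A + F A.
Proof. by move=> mA; apply: split_density => // x; rewrite /f; ring. Qed.
Let MG A : measurable A -> \int[mu]_(x in A) (q x)%:E = M A + G A.
Proof. by move=> mA; apply: split_density => // x; rewrite /g; ring. Qed.

Let MF1 : M setT + F setT = 1. Proof. by rewrite -MF. Qed.
Let M_fin : M setT \is a fin_num.
Proof. by rewrite ge0_fin_numE ?measure_ge0// (@le_lt_trans _ _ 1) ?ltry// -MF1 leeDl ?measure_ge0. Qed.
Let FG : F setT = G setT.
Proof.
have : M setT + F setT = M setT + G setT by rewrite MF1 -MG.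
by move/(congr1 (fun z => z - M setT)); rewrite ![M setT + _]addeC !addeK.
Qed.
Let F_fin : F setT < +oo.
Proof. by rewrite (@le_lt_trans _ _ 1) ?ltry// -MF1 leeDr ?measure_ge0. Qed.

(** [W1_le_split] forms a product measure and so takes bundled finite measures; this packs one from
    a bound on the total mass. *)
Let finite (H : {measure set R -> \bar R}) : H setT < +oo ->
  exists H' : {finite_measure set R -> \bar R}, forall A, H' A = H A.
Proof.
case: H => H cH; pose H0 : {measure set R -> \bar R} := Measure.Pack cH.
rewrite -/H0 => Hoo; have Hfin : fin_num_fun H0.
  move=> A mA; rewrite ge0_fin_numE ?measure_ge0// (le_lt_trans _ Hoo)//.
  by rewrite le_measure ?inE.
pose H' : {finite_measure set R -> \bar R} :=
  HB.pack (Measure.sort H0) (Measure_isFinite.Build _ _ _ H0 Hfin).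
by exists H'.
Qed.

Let mx : measurable_fun setT (fun x : R => `|x|%:E : \bar R).
Proof. by apply/measurable_EFinP; exact: normr_measurable. Qed.

Lemma W1_le_weighted_TV (P Q : set R -> \bar R) :
  (forall A, measurable A -> P A = \int[mu]_(x in A) (p x)%:E) ->
  (forall A, measurable A -> Q A = \int[mu]_(x in A) (q x)%:E) ->
  W1 P Q <= \int[mu]_x (`|x| * `|p x - q x|)%:E.
Proof.
move=> PE QE.
have [FF FE] := finite F_fin.
have [GG GE] : exists GG : {finite_measure set R -> \bar R}, forall A, GG A = G A.
  by apply: finite; rewrite -FG.
have FFe (k : R -> \bar R) : \int[FF]_x k x = \int[F]_x k x.
  by apply: eq_measure_integral => A _ _; exact: FE.
have GGe (k : R -> \bar R) : \int[GG]_x k x = \int[G]_x k x.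
  by apply: eq_measure_integral => A _ _; exact: GE.
have MF1' : M setT + FF setT = 1 by rewrite FE.
have FG' : FF setT = GG setT by rewrite FE GE.
apply: (le_trans (W1_le_split MF1' FG' _ _)).
- by move=> A mA; rewrite FE PE// MF.
- by move=> A mA; rewrite GE QE// MG.
rewrite FFe GGe.
have -> : \int[F]_x `|x|%:E = \int[mu]_x (`|x|%:E * (f x)%:E).
  by apply: ge0_integral_mdensity => // x; rewrite lee_fin.
have -> : \int[G]_x `|x|%:E = \int[mu]_x (`|x|%:E * (g x)%:E).
  by apply: ge0_integral_mdensity => // x; rewrite lee_fin.
rewrite -ge0_integralD//; last 4 first.
- by move=> x _; rewrite mule_ge0 ?lee_fin.
- by apply: emeasurable_funM => //; exact/measurable_EFinP.
- by move=> x _; rewrite mule_ge0 ?lee_fin.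
- by apply: emeasurable_funM => //; exact/measurable_EFinP.
rewrite le_eqVlt; apply/orP; left; apply/eqP; apply: eq_integral => x _.
rewrite -!EFinM -EFinD; congr EFin; rewrite -fg; move: (f x) (g x) => u v; ring.
Qed.
End density_coupling.

(** * Maximum likelihood and the empirical chi-square distance *)

Section hellinger.
Context {R : realType}.
Variables (K n : nat) (h g : nat -> R) (X : 'I_n -> 'I_K).
Hypotheses (n0 : (0 < n)%N).
Hypotheses (h0 : forall x, 0 <= h x) (g0 : forall x, 0 <= g x).
Hypotheses (h1 : \sum_(x < K) h x <= 1) (g1 : \sum_(x < K) g x <= 1).
Hypotheses (hX : forall i, 0 < h (X i)).
Hypothesis (hg : \prod_(i < n) h (X i) <= \prod_(i < n) g (X i)).

Let emp (x : 'I_K) : R := (\sum_(i < n) (X i == x)%:R) / n%:R.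

Let sum_emp (f : 'I_K -> R) : \sum_(x < K) emp x * f x = (\sum_(i < n) f (X i)) / n%:R.
Proof.
under eq_bigr do rewrite /emp mulrAC mulr_suml.
rewrite -mulr_suml exchange_big/=; congr (_ / _); apply: eq_bigr => i _.
rewrite (bigD1 (X i))//= eqxx mul1r big1 ?addr0// => x xi.
by rewrite eq_sym (negbTE xi) mul0r.
Qed.

Let emp_total : \sum_(x < K) emp x = 1.
Proof.
under eq_bigr do rewrite -[emp _]mulr1.
by rewrite sum_emp sumr_const card_ord divff// pnatr_eq0 -lt0n.
Qed.

(* AM-GM turns the likelihood comparison into a bound on the empirical mean of [sqrt (g / h)]. *)
Let sqrt_ratio_mean : 1 <= \sum_(x < K) emp x * Num.sqrt (g x / h x).
Proof.
rewrite sum_emp.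
set y := fun i : 'I_n => Num.sqrt (g (X i) / h (X i)).
have y0 i : 0 <= y i by exact: sqrtr_ge0.
have := @leif_AGM R 'I_n predT (fun i => y i) (fun i _ => y0 i).
move=> -[+ _]; rewrite cardT size_enum_ord /=; set a := _ / _ => ha.
have a0 : 0 <= a by rewrite divr_ge0 ?sumr_ge0 ?ler0n.
(* The square of this product is the likelihood ratio of [g] to [h], at least 1 by [hg]. *)
have p1 : 1 <= \prod_(i < n) y i.
  rewrite -(@expr_ge1 _ 2) ?prodr_ge0// -prodrXl.
  under eq_bigr do rewrite /y sqr_sqrtr ?divr_ge0//.
  rewrite big_split/= prodfV ler_pdivlMr ?mul1r//.
  exact: prodr_gt0.
by rewrite -(@expr_ge1 _ n)// (le_trans p1).
Qed.

(* With [u] the root of [g / h], [\sum emp * u >= 1] bounds the Hellinger affinity [\sum h * u] from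
   below up to [\sum (h - emp) * (u - 1)], which is absorbed by Cauchy-Schwarz. *)
Lemma hellinger_mle :
  \sum_(x < K) (Num.sqrt (h x) - Num.sqrt (g x)) ^+ 2 <=
  4 * (\sum_(x < K) (((\sum_(i < n) (X i == x)%:R) / n%:R - h x) ^+ 2 / h x))
  + 4 * (1 - \sum_(x < K) h x).
Proof.
set D := (X in X <= _); set chi := \sum_(x < K) _; set tau := 1 - _.
have DE : D = \sum_(x < K) h x + \sum_(x < K) g x - 2 * \sum_(x < K) (Num.sqrt (h x) * Num.sqrt (g x)).
  rewrite mulr_sumr -big_split/= -sumrB; apply: eq_bigr => x _.
  by rewrite sqrrB !sqr_sqrtr//; ring.
(* Observed values have positive probability, so a cell with [h x = 0] is empty and the convention
   that dividing by 0 gives 0 is harmless there. *)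
have emph (x : 'I_K) : h x = 0 -> emp x = 0.
  move=> hx; rewrite /emp big1 ?mul0r// => i _; case: eqP => // xi.
  by have := hX i; rewrite xi hx ltxx.
pose A (x : 'I_K) := (h x - emp x) * (Num.sqrt (g x / h x) - 1).
have AE : \sum_(x < K) (Num.sqrt (h x) * Num.sqrt (g x)) =
    \sum_(x < K) emp x * Num.sqrt (g x / h x) - tau + \sum_(x < K) A x.
  rewrite /tau -emp_total -sumrB -sumrB -big_split/=; apply: eq_bigr => x _.
  rewrite /A; have [hx|hx] := eqVneq (h x) 0.
    by rewrite emph// hx sqrtr0; ring.
  have hx0 : 0 < h x by rewrite lt_neqAle eq_sym hx h0.
  have -> : Num.sqrt (g x / h x) = Num.sqrt (g x) / Num.sqrt (h x).
    by rewrite sqrtrM// sqrtrV.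
  have sh : Num.sqrt (h x) != 0 by rewrite gt_eqF// sqrtr_gt0.
  by have := sqr_sqrtr (ltW hx0); move: (Num.sqrt (h x)) sh => t t0 <-; field.
have AM x : - A x <= (emp x - h x) ^+ 2 / h x + (Num.sqrt (h x) - Num.sqrt (g x)) ^+ 2 / 4.
  rewrite /A; have [hx|hx] := eqVneq (h x) 0.
    rewrite emph// hx subrr !mul0r oppr0 expr0n mul0r add0r.
    by rewrite divr_ge0 ?sqr_ge0.
  have hx0 : 0 < h x by rewrite lt_neqAle eq_sym hx h0.
  have -> : Num.sqrt (g x / h x) = Num.sqrt (g x) / Num.sqrt (h x).
    by rewrite sqrtrM// sqrtrV.
  have sh : 0 < Num.sqrt (h x) by rewrite sqrtr_gt0.
  move: (emp x) => e; have := sqr_sqrtr (ltW hx0); move: (Num.sqrt (h x)) sh => t t0 <-.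
  move: (Num.sqrt (g x)) => u; rewrite -subr_ge0.
  (* With [t] and [u] the roots of [h x] and [g x], the inequality is a completed square. *)
  suff -> : (e - t ^+ 2) ^+ 2 / t ^+ 2 + (t - u) ^+ 2 / 4 - - ((t ^+ 2 - e) * (u / t - 1))
    = ((e - t ^+ 2) / t + (t - u) / 2) ^+ 2 by exact: sqr_ge0.
  by field; rewrite gt_eqF.
have sA : - (\sum_(x < K) A x) <= chi + D / 4.
  by rewrite -sumrN /chi /D mulr_suml -big_split/=; apply: ler_sum => x _; exact: AM.
(* Together these give [D <= tau + 2 * chi + D / 2], and the last term moves to the left. *)
by move: sqrt_ratio_mean h1 g1 sA; rewrite DE AE /tau; lra.
Qed.
End hellinger.

(** * Moments of the empirical frequencies under a sub-probability *)

Section empirical_variance.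
Context {R : realType}.
Variables (K n : nat) (h : 'I_K -> R).
Hypotheses (h0 : forall x, 0 <= h x) (h1 : \sum_x h x <= 1).

Let L (X : {ffun 'I_n -> 'I_K}) : R := \prod_(i < n) h (X i).

Let prod_le1 (P : pred 'I_n) : 0 <= \prod_(k < n | P k) \sum_x h x <= 1.
Proof.
have H0 : 0 <= \sum_x h x by exact: sumr_ge0.
apply/andP; split; first exact: prodr_ge0.
by rewrite prodr_ile1// => i _; rewrite H0 h1.
Qed.

Lemma sum_likelihood_le1 : \sum_X L X <= 1.
Proof.
rewrite -(bigA_distr_bigA (fun=> h)).
by have /andP[] := prod_le1 predT.
Qed.

(** Independence: the sum over samples distributes into a product over coordinates. The conditionals
    treat [i = j] and [i != j] in one formula. *)
Let pair_moment (g : 'I_K -> R) i j :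
  \sum_X L X * (g (X i) * g (X j)) =
  \prod_(k < n) \sum_x h x * ((if k == i then g x else 1) * (if k == j then g x else 1)).
Proof.
rewrite bigA_distr_bigA/=; apply: eq_bigr => X _.
rewrite big_split/= big_split/= -/(L X); congr (_ * (_ * _)).
- by rewrite (bigD1 i)//= eqxx big1 ?mulr1// => k /negbTE ->.
- by rewrite (bigD1 j)//= eqxx big1 ?mulr1// => k /negbTE ->.
Qed.

Let pair_moment_eq g i : \sum_X L X * (g (X i) * g (X i)) <= \sum_x h x * g x ^+ 2.
Proof.
rewrite pair_moment (bigD1 i)//= eqxx -[leRHS]mulr1.
under eq_bigr do rewrite -expr2.
apply: ler_pM => //.
- by apply: sumr_ge0 => x _; rewrite mulr_ge0 ?sqr_ge0.
- apply: prodr_ge0 => k /negbTE ->; apply: sumr_ge0 => x _; by rewrite !mulr1.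
- rewrite (eq_bigr (fun=> \sum_x h x)) ?(andP (prod_le1 _)).2// => k /negbTE ->.
  by apply: eq_bigr => x _; rewrite !mulr1.
Qed.

Let pair_moment_neq g i j : i != j ->
  \sum_X L X * (g (X i) * g (X j)) <= (\sum_x h x * g x) ^+ 2.
Proof.
move=> ij; rewrite pair_moment (bigD1 i)//= eqxx (negbTE ij).
rewrite (bigD1 j)//=; last by rewrite eq_sym.
rewrite eqxx eq_sym (negbTE ij) mulrA.
under eq_bigr do rewrite mulr1.
under [X in _ * X * _]eq_bigr do rewrite mul1r.
rewrite -expr2 -[leRHS]mulr1 ler_wpM2l ?sqr_ge0//.
rewrite (eq_bigr (fun=> \sum_x h x)) ?(andP (prod_le1 _)).2// => k /andP[/negbTE -> /negbTE ->].
by apply: eq_bigr => x _; rewrite !mulr1.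
Qed.

(** Diagonal pairs give the first term, off-diagonal pairs the second. The latter remains because
    [h] may have mass below 1, so that indicators minus [h x] are not exactly centred. *)
Lemma second_moment (g : 'I_K -> R) :
  \sum_X L X * (\sum_(i < n) g (X i)) ^+ 2 <=
  n%:R * (\sum_x h x * g x ^+ 2) + n%:R ^+ 2 * (\sum_x h x * g x) ^+ 2.
Proof.
set S1 := \sum_x h x * _; set S2 := (\sum_x h x * g x) ^+ 2.
have S20 : 0 <= S2 by exact: sqr_ge0.
under eq_bigr do rewrite expr2 mulr_suml.
under eq_bigr do under eq_bigr do rewrite mulr_sumr.
under eq_bigr do rewrite mulr_sumr.
rewrite exchange_big/=.
apply: (@le_trans _ _ (\sum_(i < n) (S1 + n%:R * S2))).
  apply: ler_sum => i _; under eq_bigr do rewrite mulr_sumr.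
  rewrite exchange_big/= (bigD1 i)//= lerD ?pair_moment_eq//.
  apply: (@le_trans _ _ (\sum_(j < n | j != i) S2)).
    by apply: ler_sum => j ji; rewrite pair_moment_neq// eq_sym.
  apply: (@le_trans _ _ (\sum_(j < n) S2)); last by rewrite sumr_const card_ord mulr_natl.
  by rewrite [leRHS](bigD1 i)//= lerDr.
by rewrite sumr_const card_ord -mulr_natl; lra.
Qed.

(** In cell [x] the deviation is the mean of [g v = (v == x) - h x], whose first moment is [h x * t]
    and second moment at most [h x]. After division by [h x] the cell costs [1 / n + h x * t ^ 2],
    and the sum of the last terms is at most [t]. *)
Lemma expected_chi_square : (0 < n)%N ->
  \sum_(X : {ffun 'I_n -> 'I_K}) L X *
    (\sum_x ((\sum_(i < n) (X i == x)%:R) / n%:R - h x) ^+ 2 / h x) <=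
  K%:R / n%:R + (1 - \sum_x h x).
Proof.
move=> n0; have nR : 0 < n%:R :> R by rewrite ltr0n.
set t := 1 - _.
have t0 : 0 <= t by rewrite subr_ge0.
have t1 : t <= 1 by rewrite /t gerBl sumr_ge0.
under eq_bigr do rewrite mulr_sumr.
rewrite exchange_big/=.
apply: (@le_trans _ _ (\sum_x (n%:R^-1 + h x * t ^+ 2))).
  apply: ler_sum => x _.
  have [hx|hx] := eqVneq (h x) 0.
    rewrite hx big1 ?mul0r ?addr0 ?invr_ge0 ?ler0n// => X _.
    by rewrite invr0 !mulr0.
  have hx0 : 0 < h x by rewrite lt_neqAle eq_sym hx h0.
  pose g (v : 'I_K) : R := (v == x)%:R - h x.
  have Eg (F : 'I_K -> R) : \sum_v h v * ((v == x)%:R * F v) = h x * F x.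
    rewrite (bigD1 x)//= eqxx mul1r big1 ?addr0// => v /negbTE ->.
    by rewrite mul0r mulr0.
  have g1 : \sum_v h v * g v = h x * t.
    rewrite -[RHS]mulrC /t mulrBl mul1r mulr_suml -{1}[h x]mulr1 -(Eg (fun=> 1)) -sumrB.
    by apply: eq_bigr => v _; rewrite /g; ring.
  have g2 : \sum_v h v * g v ^+ 2 <= h x.
    have -> : \sum_v h v * g v ^+ 2 = h x * (1 - 2 * h x) + \sum_v h v * (h x) ^+ 2.
      rewrite -(Eg (fun=> 1 - 2 * h x)) -big_split/=; apply: eq_bigr => v _.
      by rewrite /g; case: (v == x) => /=; ring.
    rewrite -mulr_suml; have := ler_wpM2r (sqr_ge0 (h x)) h1.
    by have := sqr_ge0 (h x); rewrite expr2; lra.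
  have -> : \sum_X L X * (((\sum_(i < n) (X i == x)%:R) / n%:R - h x) ^+ 2 / h x)
      = (\sum_X L X * (\sum_(i < n) g (X i)) ^+ 2) / (n%:R ^+ 2 * h x).
    rewrite mulr_suml; apply: eq_bigr => X _.
    rewrite /g sumrB sumr_const card_ord -[_ *+ n]mulr_natl.
    by field; rewrite hx gt_eqF.
  rewrite ler_pdivrMr ?mulr_gt0 ?exprn_gt0//.
  apply: (le_trans (second_moment g)); rewrite g1.
  have -> : (n%:R^-1 + h x * t ^+ 2) * (n%:R ^+ 2 * h x) = n%:R * h x + n%:R ^+ 2 * (h x * t) ^+ 2.
    by field; rewrite gt_eqF.
  by rewrite lerD2r ler_wpM2l ?ler0n.
rewrite big_split/= sumr_const card_ord -[_ *+ K]mulr_natl -mulr_suml lerD2l.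
rewrite (le_trans (ler_piMl (sqr_ge0 t) h1))// expr2 ler_piMl//.
Qed.
End empirical_variance.

(** * From finite alphabets to samples in [nat] *)

Section expected_risk.
Context {R : realType}.
Variables (n K : nat) (h : nat -> R).
Hypotheses (h0 : forall x, 0 <= h x) (h1 : forall N, \sum_(x < N) h x <= 1).

Let L (X : 'I_n -> nat) : R := \prod_(i < n) h (X i).
Let emb N (X : {ffun 'I_n -> 'I_N}) (i : 'I_n) : nat := X i.
Arguments emb : clear implicits.

(** The extended sum is a supremum over finite sets of samples, and the entries of finitely many
    samples lie below a common [N]. *)
Let esum_le (F : ('I_n -> nat) -> \bar R) (c : \bar R) :
  (forall X, 0 <= F X)%E ->
  (forall N, (K < N)%N -> (\sum_(X : {ffun 'I_n -> 'I_N}) F (emb N X) <= c)%E) ->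
  (\esum_(X in [set: 'I_n -> nat]) F X <= c)%E.
Proof.
move=> F0 H; apply: ub_ereal_sup => _ [A [finA _] <-].
have /finite_seqP[s As] := finA.
have [N KN HN] : exists2 N, (K <= N)%N & forall X, X \in s -> forall i, (X i < N.+1)%N.
  elim: (s : seq ('I_n -> nat)) => [|Y t [N KN HN]]; first by exists K.
  exists (maxn N (\max_(i < n) Y i)); first by rewrite leq_max KN.
  move=> X; rewrite inE => /predU1P[->|Xt] i; rewrite ltnS leq_max.
    by rewrite leq_bigmax orbT.
  by rewrite -ltnS HN.
have -> : A = [set` undup s].
  by rewrite As; apply/seteqP; split=> X /=; rewrite mem_undup.
rewrite -fsbig_seq ?undup_uniq//.
pose g (X : 'I_n -> nat) : {ffun 'I_n -> 'I_N.+1} := [ffun i => inord (X i)].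
have gK X : X \in s -> emb N.+1 (g X) = X.
  by move=> Xs; apply/funext => i; rewrite /emb ffunE inordK// HN.
apply: (le_trans _ (H N.+1 KN)).
have -> : (\sum_(X <- undup s) F X = \sum_(f <- map g (undup s)) F (emb N.+1 f))%E.
  rewrite big_map; apply: eq_big_seq => // X; rewrite mem_undup => Xs.
  by rewrite gK.
rewrite big_uniq/=; last first.
  rewrite map_inj_in_uniq ?undup_uniq// => X Y; rewrite !mem_undup => Xs Ys gXY.
  by rewrite -(gK X)// gXY gK.
rewrite [leRHS](bigID (mem (map g (undup s))))/= leeDl// sume_ge0//.
Qed.

Let chi (X : 'I_n -> nat) : R :=
  \sum_(x < K.+1) ((\sum_(i < n) (X i == x)%:R) / n%:R - h x) ^+ 2 / h x.
Let tau : R := 1 - \sum_(x < K.+1) h x.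

(** Samples with all entries at most [K] are samples over [K.+1] cells, where [expected_chi_square]
    applies. The others have total weight at most [1 - (1 - tau) ^ n <= n * tau] and are charged the
    crude bound [c]. *)
Lemma expected_risk_le (w : ('I_n -> nat) -> \bar R) (a b c : R) : (0 < n)%N ->
  0 <= a -> 0 <= b -> 0 <= c -> (forall X, 0 <= w X)%E ->
  (forall X, (forall i, 0 < h (X i)) -> (w X <= c%:E)%E) ->
  (forall X, (forall i, 0 < h (X i)) -> (forall i, (X i <= K)%N) ->
    (w X <= (a * chi X + b)%:E)%E) ->
  (\esum_(X in [set: 'I_n -> nat]) (L X)%:E * w X <=
    (a * (K.+1%:R / n%:R + tau) + b + c * (n%:R * tau))%:E)%E.
Proof.
move=> n0 a0 b0 c0 w0 wc wab.
have L0 X : 0 <= L X by exact: prodr_ge0.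
(* A sample with an entry of probability 0 has weight 0, so [w] need only be bounded on the
   remaining ones. *)
have Lw X (v : R) : (0 <= v) -> ((forall i, 0 < h (X i)) -> (w X <= v%:E)%E) ->
    ((L X)%:E * w X <= (L X * v)%:E)%E.
  move=> v0 H; have [LX|LX] := eqVneq (L X) 0; first by rewrite LX mul0e mul0r.
  rewrite EFinM lee_wpmul2l ?lee_fin//; apply: H => i.
  rewrite lt_neqAle eq_sym h0 andbT; apply: contra_neq LX => hi.
  by rewrite /L (bigD1 i)//= hi mul0r.
apply: esum_le => [X|N KN]; first by rewrite mule_ge0 ?lee_fin.
pose good (X : {ffun 'I_n -> 'I_N}) := [forall i, (X i <= K)%N].
have chi0 X : 0 <= chi X.
  by apply: sumr_ge0 => x _; rewrite divr_ge0 ?sqr_ge0.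
have v0 X : 0 <= a * chi X + b by rewrite addr_ge0 ?mulr_ge0.
pose wid (Y : {ffun 'I_n -> 'I_K.+1}) : {ffun 'I_n -> 'I_N} := [ffun i => widen_ord KN (Y i)].
pose nar (X : {ffun 'I_n -> 'I_N}) : {ffun 'I_n -> 'I_K.+1} := [ffun i => inord (X i)].
have embw Y : emb N (wid Y) = emb K.+1 Y by apply/funext => i; rewrite /emb ffunE.
have goodE (G : ('I_n -> nat) -> R) :
    \sum_(X | good X) G (emb N X) = \sum_Y G (emb K.+1 Y).
  rewrite (reindex_onto wid nar)/=; last first.
    move=> X /forallP gX; apply/ffunP => i; apply: val_inj.
    by rewrite /= !ffunE/= inordK// ltnS.
  apply: eq_big => [Y|Y _]; last by rewrite embw.
  apply/andP; split; first by apply/forallP => i; rewrite ffunE/= -ltnS.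
  apply/eqP/ffunP => i; apply: val_inj; by rewrite /= !ffunE/= inordK.
have good_mass : \sum_(X | good X) L (emb N X) = (\sum_(x < K.+1) h x) ^+ n.
  rewrite goodE /L /emb -(bigA_distr_bigA (fun=> fun x : 'I_K.+1 => h x)).
  by rewrite prodr_const card_ord.
have tot_mass : \sum_X L (emb N X) <= 1.
  exact: (@sum_likelihood_le1 R N n (fun x => h x) (fun x => h0 x) (h1 N)).
rewrite (bigID good)/= EFinD; apply: leeD.
  apply: (@le_trans _ _ (\sum_(X | good X) (L (emb N X) * (a * chi (emb N X) + b))%:E)%E).
    apply: lee_sum => X /forallP gX; apply: Lw => // hX; exact: wab.
  rewrite sumEFin lee_fin (goodE (fun X => L X * (a * chi X + b))).
  under eq_bigr do rewrite mulrDr mulrCA.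
  rewrite big_split/= -mulr_sumr -mulr_suml lerD//.
    rewrite ler_wpM2l//.
    exact: (@expected_chi_square R K.+1 n (fun x => h x) (fun x => h0 x) (h1 K.+1)).
  rewrite ler_piMl//.
  exact: (@sum_likelihood_le1 R K.+1 n (fun x => h x) (fun x => h0 x) (h1 K.+1)).
apply: (@le_trans _ _ (\sum_(X | ~~ good X) (L (emb N X) * c)%:E)%E).
  by apply: lee_sum => X _; apply: Lw => // hX; exact: wc.
rewrite sumEFin lee_fin -mulr_suml mulrC ler_wpM2l//.
have H0 : 0 <= \sum_(x < K.+1) h x by exact: sumr_ge0.
have bern : 1 - (\sum_(x < K.+1) h x) ^+ n <= n%:R * tau.
  rewrite /tau; move: (h1 K.+1) H0; move: (\sum_(x < _) _) => H H1 H0.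
  clear -H1 H0; elim: n => [|m IH]; first by rewrite expr0 subrr mul0r.
  rewrite exprS -natr1 mulrDl mul1r.
  have -> : 1 - H * H ^+ m = H * (1 - H ^+ m) + (1 - H) by ring.
  rewrite lerD2r (le_trans _ IH)// ler_piMl// subr_ge0.
  exact: exprn_ile1.
apply: (le_trans _ bern); rewrite -good_mass lerBrDl.
by rewrite (bigID good)/= in tot_mass.
Qed.
End expected_risk.

(** * Gaussian mixtures *)

Section gaussian_mixture.
Context (R : realType) (s : R).
Hypotheses (s_gt0 : 0 < s).
Local Notation mu := (@lebesgue_measure R).
Variable Q : probability R R.

Lemma measurable_normal_pdf2 : measurable_fun [set: R * R] (fun z : R * R => normal_pdf z.1 s z.2).
Proof.
rewrite (_ : (fun _ => _) = (fun z : R * R => normal_pdf 0 s (z.2 - z.1))); last first.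
  apply/funext => z; rewrite /normal_pdf (gt_eqF s_gt0).
  by rewrite /normal_fun subr0.
apply: (measurableT_comp (measurable_normal_pdf 0 s)).
by apply: measurable_funB; [exact: measurable_snd|exact: measurable_fst].
Qed.

Definition mixture_pdf (x : R) : R := fine (\int[Q]_t (normal_pdf t s x)%:E)%E.

Let mixture_pdf_fin x : (\int[Q]_t (normal_pdf t s x)%:E)%E \is a fin_num.
Proof.
rewrite ge0_fin_numE; last first.
  by apply: integral_ge0 => t _; rewrite lee_fin normal_pdf_ge0.
apply: (@le_lt_trans _ _ (\int[Q]_t (cst (normal_peak s)%:E t))%E).
  apply: ge0_le_integral => //.
  - by move=> t _; rewrite lee_fin normal_pdf_ge0.
  - apply/measurable_EFinP.
    exact: (measurableT_comp measurable_normal_pdf2 (measurable_pair2 x)).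
  - by move=> t _; rewrite lee_fin normal_pdf_ub// gt_eqF.
by rewrite integral_cst// [X in (_ * X)%E]probability_setT mule1 ltry.
Qed.

Lemma mixture_pdfE x : (mixture_pdf x)%:E = (\int[Q]_t (normal_pdf t s x)%:E)%E.
Proof. by rewrite fineK. Qed.

Lemma mixture_pdf_ge0 x : 0 <= mixture_pdf x.
Proof. by apply: fine_ge0; apply: integral_ge0 => t _; rewrite lee_fin normal_pdf_ge0. Qed.

Lemma measurable_mixture_pdf : measurable_fun setT mixture_pdf.
Proof.
apply/measurable_EFinP.
rewrite (_ : _ \o _ = fubini_G Q (fun z : R * R => (normal_pdf z.1 s z.2)%:E)).
  apply: measurable_fun_fubini_tonelli_G.
    by apply/measurable_EFinP; exact: measurable_normal_pdf2.
  by move=> z; rewrite lee_fin normal_pdf_ge0.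
by apply/funext => x; rewrite /= mixture_pdfE.
Qed.

Lemma gauss_conv_density A : measurable A ->
  gauss_conv s Q A = (\int[mu]_(x in A) (mixture_pdf x)%:E)%E.
Proof.
move=> mA; rewrite /gauss_conv /normal_prob.
pose f (z : R * R) : \bar R := ((normal_pdf z.1 s z.2) * \1_A z.2)%:E.
have mf : measurable_fun setT f.
  apply/measurable_EFinP; apply: measurable_funM; first exact: measurable_normal_pdf2.
  exact: (measurableT_comp (measurable_indic mA) measurable_snd).
have f0 z : (0 <= f z)%E by rewrite lee_fin mulr_ge0 ?normal_pdf_ge0.
have patchE (u : R -> R) x : (((fun x => (u x)%:E) \_ A) x = (u x * \1_A x)%:E)%E.
  by rewrite patchE indicE; case: ifP => _; rewrite ?mulr1 ?mulr0.
transitivity (\int[Q]_t \int[mu]_x f (t, x))%E.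
  apply: eq_integral => t _; rewrite integral_mkcond.
  by apply: eq_integral => x _; rewrite patchE.
rewrite (fubini_tonelli (m1 := Q) (m2 := mu))//.
rewrite [RHS]integral_mkcond; apply: eq_integral => x _.
rewrite patchE EFinM mixture_pdfE -ge0_integralZr//.
- apply/measurable_EFinP.
  exact: (measurableT_comp measurable_normal_pdf2 (measurable_pair2 x)).
- by move=> t _; rewrite lee_fin normal_pdf_ge0.
Qed.

Lemma integral_mixture_pdf : (\int[mu]_x (mixture_pdf x)%:E = 1)%E.
Proof.
rewrite -gauss_conv_density// /gauss_conv.
under eq_integral do rewrite probability_setT.
by rewrite -[RHS]mule1 -[X in _ = (_ * X)%E](probability_setT Q); exact: integral_cst.
Qed.
End gaussian_mixture.

(** * Expansion of the Gaussian kernel in Poisson weights *)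

Section exp_taylor.
Context {R : realType}.
Implicit Types (x y : R) (M N n k : nat).

(** The sum stops at degree [M - 1]; in particular it is 0 for [M = 0], where the remainder bound is
    still valid. *)
Definition exp_trunc M x : R := \sum_(i < M) x ^+ i / i`!%:R.

Let exp_truncE x : (exp_trunc ^~ x) = series (exp_coeff x).
Proof. by apply/funext => M; rewrite /exp_trunc /series/= big_mkord. Qed.

Let cvg_exp_trunc x : exp_trunc ^~ x @ \oo --> expR x.
Proof. by rewrite exp_truncE; exact: is_cvg_series_exp_coeff. Qed.

Lemma exp_trunc_ge0 M x : 0 <= x -> 0 <= exp_trunc M x.
Proof. by move=> x0; apply: sumr_ge0 => i _; rewrite divr_ge0 ?exprn_ge0 ?ler0n. Qed.

Lemma exp_trunc_le_expR M x : 0 <= x -> exp_trunc M x <= expR x.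
Proof.
move=> x0; have := @cvg_exp_trunc x; rewrite exp_truncE => c.
rewrite [leLHS](congr1 (fun f => f M) (exp_truncE x)) -(cvg_lim _ c)//.
apply: nondecreasing_cvgn_le; last by apply/cvg_ex; eexists; exact: c.
by apply: nondecreasing_series => i _ _; rewrite /exp_coeff/= divr_ge0 ?exprn_ge0 ?ler0n.
Qed.

Lemma norm_exp_trunc_le M x : `|exp_trunc M x| <= expR `|x|.
Proof.
apply: (le_trans _ (exp_trunc_le_expR M (normr_ge0 x))).
apply: (le_trans (ler_norm_sum _ _ _)); apply: ler_sum => i _.
by rewrite normrM normrX normfV (ger0_norm (ler0n _ _)).
Qed.

Lemma leq_fact_mul m k : (m`! * k`! <= (m + k)`!)%N.
Proof. by rewrite -(@bin_fact (m + k) m) ?leq_addr// addKn leq_pmull// bin_gt0 leq_addr. Qed.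

Lemma expr_fact_le_expR k x : 0 <= x -> x ^+ k / k`!%:R <= expR x.
Proof.
move=> x0; apply: (le_trans _ (exp_trunc_le_expR k.+1 x0)).
by rewrite /exp_trunc big_ord_recr/= lerDr exp_trunc_ge0.
Qed.

(** By [m! * k! <= (m + k)!] each tail term is at most [|x| ^ M / M!] times a term of the series of
    [expR |x|]. This is shown for finite tails and passed to the limit. *)
Lemma exp_taylor_bound M x :
  `|expR x - exp_trunc M x| <= `|x| ^+ M / M`!%:R * expR `|x|.
Proof.
have part N : `|exp_trunc (M + N) x - exp_trunc M x| <= `|x| ^+ M / M`!%:R * expR `|x|.
  rewrite /exp_trunc big_split_ord/= addrAC subrr add0r.
  apply: (le_trans (ler_norm_sum _ _ _)).
  apply: (@le_trans _ _ (`|x| ^+ M / M`!%:R * exp_trunc N `|x|)); last first.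
    by rewrite ler_wpM2l ?divr_ge0 ?exprn_ge0 ?ler0n// exp_trunc_le_expR.
  rewrite /exp_trunc mulr_sumr; apply: ler_sum => i _.
  rewrite normrM normrX normfV (ger0_norm (ler0n _ _)) exprD mulf_div.
  rewrite ler_wpM2l ?mulr_ge0 ?exprn_ge0// lef_pV2 ?posrE -?natrM ?ltr0n ?muln_gt0 ?fact_gt0//.
  by rewrite ler_nat leq_fact_mul.
have c : `|exp_trunc (M + N) x - exp_trunc M x| @[N --> \oo] --> `|expR x - exp_trunc M x|.
  apply: cvg_norm; apply: cvgB; last exact: cvg_cst.
  have := @cvg_exp_trunc x; rewrite -(cvg_shiftn M).
  by under eq_fun do rewrite addnC.
rewrite -(cvg_lim _ c)//; apply: limr_le; first by apply/cvg_ex; eexists; exact: c.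
by apply: nearW.
Qed.

(** A single term of the series of [expR (x ^ 2)] is at most the whole; then take square roots. *)
Lemma norm_expr_le_sqrt_fact k x : `|x| ^+ k <= Num.sqrt k`!%:R * expR (x ^+ 2 / 2).
Proof.
have H := expr_fact_le_expR k (sqr_ge0 x).
rewrite ler_pdivrMr ?ltr0n ?fact_gt0// in H.
rewrite -ler_sqr ?nnegrE ?exprn_ge0 ?mulr_ge0 ?sqrtr_ge0 ?expR_ge0//.
rewrite exprMn sqr_sqrtr ?ler0n// -expRM_natl mulrCA divff// mulr1 mulrC.
by rewrite -exprM mulnC exprM real_normK// num_real.
Qed.
End exp_taylor.

(** * Poisson mixture probabilities as expectations over [[0, th]] *)

Section supported_expectation.
Context {R : realType} (th : R).
Hypothesis th_gt0 : 0 < th.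
Variable Q : probability R R.
Hypothesis QI : supported_on th Q.
Local Notation I := (I0 th).
Local Notation E := (Rintegral Q I).

Let mI : measurable I. Proof. exact: measurable_itv. Qed.

Let bounded_integrable (f : R -> R) (B : R) : measurable_fun setT f ->
  (forall t, 0 <= t <= th -> `|f t| <= B) -> Q.-integrable I (EFin \o f).
Proof.
move=> mf fB; apply: measurable_bounded_integrable => //.
- by rewrite (le_lt_trans (probability_le1 Q mI))// ltry.
- exact: measurable_funTS.
exists B; split; first exact: num_real.
move=> M BM t It; apply: (le_trans _ (ltW BM)); apply: fB.
by move: It; rewrite /I0/= in_itv.
Qed.

Lemma measurable_pois k : measurable_fun setT (pois ^~ k : R -> R).
Proof.
apply: measurable_funM => //; apply: measurable_funM; last exact: measurable_funX.
exact: measurableT_comp.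
Qed.

Lemma pois_ge0 (t : R) k : 0 <= t -> 0 <= pois t k.
Proof. by move=> t0; rewrite /pois divr_ge0 ?mulr_ge0 ?expR_ge0 ?exprn_ge0 ?ler0n. Qed.

Lemma pois_le (t : R) k : 0 <= t <= th -> pois t k <= th ^+ k / k`!%:R.
Proof.
move=> /andP[t0 tth]; rewrite /pois ler_wpM2r ?invr_ge0 ?ler0n//.
rewrite -[leRHS]mul1r ler_pM ?expR_ge0 ?exprn_ge0//.
  by rewrite -[leRHS]expR0 ler_expR oppr_le0.
by rewrite lerXn2r ?nnegrE// (le_trans t0).
Qed.

Let pois_norm t k : 0 <= t <= th -> `|pois t k| <= th ^+ k / k`!%:R :> R.
Proof. by move=> tI; rewrite ger0_norm ?pois_le// pois_ge0//; case/andP: tI. Qed.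

Let integrable_pois k : Q.-integrable I (EFin \o (pois ^~ k)).
Proof. exact: bounded_integrable (measurable_pois k) (fun t => @pois_norm t k). Qed.

Lemma hpoisE k : hpois th Q k = E (pois ^~ k).
Proof. by []. Qed.

Let mean_cst (c : R) : E (fun=> c) = c.
Proof.
transitivity (fine (c%:E * 1%E)); last by rewrite mule1.
congr fine; rewrite integral_cst//; congr (_ * _)%E; exact: QI.
Qed.

Lemma hpois_ge0 k : 0 <= hpois th Q k.
Proof.
rewrite hpoisE; apply: Rintegral_ge0 => t; rewrite /I0/= in_itv/= => /andP[t0 _].
exact: pois_ge0.
Qed.

Let integrable_cst (c : R) : Q.-integrable I (EFin \o (fun=> c)).
Proof. exact: (@bounded_integrable _ `|c|). Qed.

Lemma hpois_le k : hpois th Q k <= th ^+ k / k`!%:R.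
Proof.
rewrite hpoisE -[leRHS]mean_cst; apply: le_Rintegral => // t.
by rewrite /I0/= in_itv/=; exact: pois_le.
Qed.

(** Integrability and value are paired so that one induction on the sum carries both. *)
Let is_mean (f : R -> R) (v : R) := Q.-integrable I (EFin \o f) /\ E f = v.

Let is_mean_sum (T : finType) (r : seq T) (c : T -> R) (k : T -> nat) :
  is_mean (fun t => \sum_(i <- r) c i * pois t (k i)) (\sum_(i <- r) c i * hpois th Q (k i)).
Proof.
elim: r => [|i r [IH1 IH2]].
  rewrite big_nil (_ : (fun t => _) = (fun=> 0)); last first.
    by apply/funext => t; rewrite big_nil.
  by split; [exact: integrable_cst|exact: mean_cst].
have ip : Q.-integrable I (EFin \o (fun t => c i * pois t (k i))).
  have := integrableZl mI (c i) (integrable_pois (k i)).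
  by congr (integrable _ _ _).
rewrite big_cons (_ : (fun t => _) =
  (fun t => c i * pois t (k i) + \sum_(j <- r) c j * pois t (k j))); last first.
  by apply/funext => t; rewrite big_cons.
split; first by have := integrableD mI ip IH1; congr (integrable _ _ _).
by rewrite RintegralD// IH2 RintegralZl.
Qed.

(** Transfers a uniform approximation by Poisson weights on [[0, th]] to expectations, with the same
    error since [Q] has mass 1 there. *)
Lemma mean_approx (T : finType) (c : T -> R) (k : T -> nat) (f : R -> R) (B rho : R) :
  measurable_fun setT f -> (forall t, `|f t| <= B) ->
  (forall t, 0 <= t <= th -> `|f t - \sum_i c i * pois t (k i)| <= rho) ->
  `|E f - \sum_i c i * hpois th Q (k i)| <= rho.
Proof.
move=> mf fB frho.
have fi : Q.-integrable I (EFin \o f) by exact: bounded_integrable.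
have [gi <-] := is_mean_sum (index_enum T) c k.
rewrite -RintegralB// (le_trans (le_normr_Rintegral _ _))//.
  by have := integrableB mI fi gi; congr (integrable _ _ _).
rewrite -[leRHS]mean_cst; apply: le_Rintegral => //.
  apply: (@bounded_integrable _ rho); last first.
    by move=> t tI; rewrite normr_id frho.
  apply: measurableT_comp => //; apply: measurable_funB => //.
  apply: measurable_sum => i; apply: measurable_funM => //; exact: measurable_pois.
Qed.

Let pois_total (t : R) N : 0 <= t -> \sum_(x < N) pois t x = expR (- t) * exp_trunc N t.
Proof.
by move=> t0; rewrite /exp_trunc mulr_sumr; apply: eq_bigr => x _; rewrite /pois mulrA.
Qed.

Lemma sum_hpois_le1 N : \sum_(x < N) hpois th Q x <= 1.
Proof.
have [gi] := is_mean_sum (index_enum 'I_N) (fun=> 1) (fun x => x).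
under [RHS]eq_bigr do rewrite mul1r.
move=> <-; rewrite -[leRHS]mean_cst; apply: le_Rintegral => // t.
rewrite /I0/= in_itv/= => /andP[t0 _]; under eq_bigr do rewrite mul1r.
rewrite pois_total// (le_trans (ler_wpM2l (expR_ge0 _) (exp_trunc_le_expR N t0)))//.
by rewrite -expRD addNr expR0.
Qed.

(** Apply [mean_approx] to the constant 1: the pointwise error is [expR (- t)] times a Taylor
    remainder of [expR t], and the exponentials cancel. *)
Lemma hpois_tail_le N : 1 - \sum_(x < N) hpois th Q x <= th ^+ N / N`!%:R.
Proof.
have := @mean_approx 'I_N (fun=> 1) (fun x => x) (fun=> 1) 1 (th ^+ N / N`!%:R).
rewrite mean_cst; under eq_bigr do rewrite mul1r.
move=> /(_ (measurable_cst _)) H; apply: (le_trans (ler_norm _)); apply: H => t.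
  by rewrite normr1.
move=> /andP[t0 tth]; under eq_bigr do rewrite mul1r.
rewrite pois_total//.
have -> : 1 - expR (- t) * exp_trunc N t = expR (- t) * (expR t - exp_trunc N t).
  by rewrite mulrBr -expRD addNr expR0.
rewrite normrM ger0_norm ?expR_ge0//.
apply: (le_trans (ler_wpM2l (expR_ge0 _) (exp_taylor_bound N t))).
rewrite ger0_norm// mulrCA -expRD addNr expR0 mulr1.
by rewrite ler_wpM2r ?invr_ge0 ?ler0n// lerXn2r ?nnegrE// (le_trans t0).
Qed.

Lemma mixture_pdf_Rintegral s x : 0 < s -> mixture_pdf s Q x = E (fun t => normal_pdf t s x).
Proof.
move=> s0; rewrite /mixture_pdf /Rintegral; congr fine.
have mpdf : measurable_fun setT (fun t : R => (normal_pdf t s x)%:E).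
  apply/measurable_EFinP.
  exact: (measurableT_comp (measurable_normal_pdf2 s0) (measurable_pair2 x)).
rewrite -(setUv I) ge0_integral_setU//=; last 4 first.
- exact: measurableC.
- by rewrite setUv.
- by move=> t _; rewrite lee_fin normal_pdf_ge0.
- by apply/disj_setPS; rewrite setICr.
rewrite [X in (_ + X)%E](_ : _ = 0%E) ?adde0//.
apply: null_set_integral => //.
- exact: measurableC.
- exact: measurable_funTS.
- transitivity (1 - Q I)%E; first exact: probability_setC.
  by transitivity (1 - 1 : \bar R)%E; [congr (_ - _)%E; exact: QI|exact: subee].
Qed.
End supported_expectation.

Section gaussian_kernel_expansion.
Context {R : realType}.
Implicit Types (t u w x y z : R) (M a j k : nat).

(** Rescaling [x] by 2 lowers the exponent from [x ^ 2 / 2] to [x ^ 2 / 8] at the price [2 ^ k]. The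
    total exponent may then stay at [z ^ 2 / 4], below the Gaussian decay. *)
Lemma norm_expr_le_sqrt_fact4 k x : `|x| ^+ k <= 2 ^+ k * Num.sqrt k`!%:R * expR (x ^+ 2 / 8).
Proof.
have := @norm_expr_le_sqrt_fact R k (x / 2).
rewrite normrM normfV (ger0_norm (ler0n _ 2)) expr_div_n ler_pdivrMr ?exprn_gt0//.
move/le_trans; apply; rewrite le_eqVlt; apply/orP; left; apply/eqP.
have -> : (x / 2) ^+ 2 / 2 = x ^+ 2 / 8 by field.
ring.
Qed.

(** Bounding a binomial coefficient by a power of 2, once for [a + 2 j] and once for [j + j]. *)
Lemma fact_add_double_le a j : ((a + j.*2)`! <= 2 ^ a * 4 ^ j.*2 * (a`! * j`! ^ 2))%N.
Proof.
have step m k : ((m + k)`! <= 2 ^ (m + k) * (m`! * k`!))%N.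
  rewrite -(@bin_fact (m + k) m) ?leq_addr// addKn leq_mul2r; apply/orP; right.
  rewrite -[(2 ^ _)%N]/((1 + 1) ^ (m + k))%N expnDn (bigD1 (inord m))//= inordK; last by rewrite ltnS leq_addr.
  by rewrite !exp1n !muln1 leq_addr.
apply: (leq_trans (step _ _)).
have := step j j; rewrite addnn -(leq_pmul2l (m := 2 ^ (a + j.*2) * a`!)); last first.
  by rewrite muln_gt0 expn_gt0 fact_gt0.
rewrite -mulnA => /leq_trans; apply.
by rewrite expnD (_ : 4 = 2 * 2)%N// expnMn -mulnn; apply/eq_leq; ring.
Qed.

(** The left side is what is left of an expansion coefficient after the gain [1 / sqrt k!], where
    [k = a + 2 j]. The squares compare with a factor [4 ^ j] to spare; the base 2 on the right is
    the 2 of [2 sqrt th / s]. *)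
Lemma sqrt_fact_weight_le a j z :
  Num.sqrt (a + j.*2)`!%:R * `|z| ^+ a / (a`!%:R * j`!%:R * 2 ^+ j) <=
  2 ^+ (a + j.*2) * expR (z ^+ 2 / 4).
Proof.
set A := a`!%:R : R; set J := j`!%:R : R.
have A0 : 0 < A by rewrite ltr0n fact_gt0.
have J0 : 0 < J by rewrite ltr0n fact_gt0.
have T0 : 0 < 2 ^+ j :> R by rewrite exprn_gt0.
have D0 : 0 < A * J * 2 ^+ j by rewrite !mulr_gt0.
rewrite ler_pdivrMr// -ler_sqr ?nnegrE; last 2 first.
- by rewrite mulr_ge0 ?sqrtr_ge0 ?exprn_ge0.
- by rewrite !mulr_ge0 ?exprn_ge0 ?expR_ge0 ?ltW.
rewrite exprMn sqr_sqrtr ?ler0n// -exprM mulnC exprM real_normK ?num_real//.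
have F : (a + j.*2)`!%:R <= 2 ^+ a * 16 ^+ j * (A * J ^+ 2) :> R.
  have := fact_add_double_le a j; rewrite -(ler_nat R) !natrM !natrX -mul2n exprM.
  by rewrite (_ : 4%:R ^+ 2 = 16 :> R)//; ring.
have G : (z ^+ 2) ^+ a <= 2 ^+ a * A * expR (z ^+ 2 / 2).
  have z0 : 0 <= z ^+ 2 / 2 by rewrite divr_ge0 ?sqr_ge0.
  have := expr_fact_le_expR a z0.
  by rewrite expr_div_n ler_pdivrMr// ler_pdivrMr ?exprn_gt0// => /le_trans; apply;
    rewrite le_eqVlt; apply/orP; left; apply/eqP; rewrite -/A; ring.
apply: (le_trans (ler_pM (ler0n _ _) (exprn_ge0 _ (sqr_ge0 z)) F G)).
have -> : (2 ^+ (a + j.*2) * expR (z ^+ 2 / 4) * (A * J * 2 ^+ j)) ^+ 2 =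
    2 ^+ a * 16 ^+ j * (A * J ^+ 2) * (2 ^+ a * A * expR (z ^+ 2 / 2)) * 4 ^+ j.
  have -> : z ^+ 2 / 2 = z ^+ 2 / 4 + z ^+ 2 / 4 by field.
  rewrite expRD exprD -mul2n exprM.
  have -> : 16 = 2 ^+ 2 * 2 ^+ 2 :> R by ring.
  have -> : 4 = 2 * 2 :> R by ring.
  rewrite !exprMn; ring.
by rewrite ler_peMr ?exprn_ege1 ?ler1n// !mulr_ge0 ?exprn_ge0 ?expR_ge0 ?ltW.
Qed.

Lemma exp_product_trunc_error M x y :
  `|expR x * expR y - exp_trunc M x * exp_trunc M y| <=
  (`|x| ^+ M + `|y| ^+ M) / M`!%:R * (expR `|x| * expR `|y|).
Proof.
have -> : expR x * expR y - exp_trunc M x * exp_trunc M y =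
  (expR x - exp_trunc M x) * expR y + exp_trunc M x * (expR y - exp_trunc M y) by ring.
apply: (le_trans (ler_normD _ _)); rewrite !normrM.
have -> : (`|x| ^+ M + `|y| ^+ M) / M`!%:R * (expR `|x| * expR `|y|) =
  `|x| ^+ M / M`!%:R * expR `|x| * expR `|y| + expR `|x| * (`|y| ^+ M / M`!%:R * expR `|y|) by ring.
apply: lerD; apply: ler_pM => //.
- exact: exp_taylor_bound.
- by rewrite ger0_norm ?expR_ge0// ler_expR ler_norm.
- exact: norm_exp_trunc_le.
- exact: exp_taylor_bound.
Qed.
End gaussian_kernel_expansion.

Section pointwise_density_bound.
Context {R : realType} (th s : R).
Hypotheses (th_gt0 : 0 < th) (s_gt0 : 0 < s).
Let s0 : s != 0. Proof. by rewrite gt_eqF. Qed.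

(** The shift by [s] compensates the factor [expR (- t)] pulled out of the kernel, since
    [t = s * (t / s)]. *)
Let zof (x : R) : R := x / s + s.
Let amp (x : R) : R := normal_peak s * expR (- ((x / s) ^+ 2 / 2)).
Let amp_ge0 x : 0 <= amp x. Proof. by rewrite mulr_ge0 ?normal_peak_ge0 ?expR_ge0. Qed.

(* The Gaussian kernel is split so that a Taylor expansion in [t / s] of the last two factors,
   multiplied by [expR (- t)], is a linear combination of Poisson weights [pois t k]. *)
Let kernel_factor t x : normal_pdf t s x =
  amp x * (expR (- t) * (expR (zof x * (t / s)) * expR (- ((t / s) ^+ 2 / 2)))).
Proof.
rewrite normal_pdfE// /amp -mulrA -!expRD; congr (_ * expR _).
by rewrite /zof -mulr_natr; field.
Qed.

(** The pair holds the orders in the two exponentials. It yields the power [t ^ k] with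
    [k = p.1 + 2 p.2], and the [k!] in the numerator cancels the one in [pois t k]. *)
Let coef M z (p : 'I_M * 'I_M) : R :=
  z ^+ p.1 * (-1) ^+ p.2 * (p.1 + p.2.*2)`!%:R /
    (p.1`!%:R * p.2`!%:R * 2 ^+ p.2 * s ^+ (p.1 + p.2.*2)).

Let trunc_pois M z t :
  expR (- t) * (exp_trunc M (z * (t / s)) * exp_trunc M (- ((t / s) ^+ 2 / 2))) =
  \sum_(p : 'I_M * 'I_M) coef z p * pois t (p.1 + p.2.*2).
Proof.
transitivity (\sum_(a < M) \sum_(j < M) coef z (a, j) * pois t (a + j.*2)).
  rewrite /exp_trunc mulr_suml mulr_sumr; apply: eq_bigr => a _.
  rewrite mulr_sumr mulr_sumr; apply: eq_bigr => j _.
  have -> : (- ((t / s) ^+ 2 / 2)) ^+ j = (-1) ^+ j * t ^+ j.*2 / (s ^+ j.*2 * 2 ^+ j).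
    have -> : - ((t / s) ^+ 2 / 2) = -1 * t ^+ 2 / (s ^+ 2 * 2) by field.
    by rewrite exprMn [(-1 * _) ^+ j]exprMn exprVn [(s ^+ 2 * 2) ^+ j]exprMn -!exprM mul2n.
  rewrite /coef /pois /= !exprMn exprVn exprD.
  have K0 : (a + j.*2)`!%:R != 0 :> R by rewrite pnatr_eq0 -lt0n fact_gt0.
  have A0 : a`!%:R != 0 :> R by rewrite pnatr_eq0 -lt0n fact_gt0.
  have J0 : j`!%:R != 0 :> R by rewrite pnatr_eq0 -lt0n fact_gt0.
  have S0 k : s ^+ k != 0 by rewrite expf_neq0.
  have T0 : 2 ^+ j != 0 :> R by rewrite expf_neq0.
  rewrite exprD; move: (S0 a) (S0 j.*2).
  move: ((a + j.*2)`!%:R : R) (a`!%:R : R) (j`!%:R : R) K0 A0 J0 => K A J K0 A0 J0.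
  move: (s ^+ a) (s ^+ j.*2) (2 ^+ j : R) (t ^+ a) (t ^+ j.*2) T0 => u v T x y T0 u0 v0.
  by field; rewrite K0 A0 J0 u0 v0 T0.
by rewrite pair_big; apply: eq_bigr => p _.
Qed.

(** In [h - g], a product of the sum and the difference of roots, the sum is at most [2 sqrt H].
    With [H = th ^ k / k!] this supplies the gain that offsets the coefficients. *)
Lemma sqrt_diff_le (h g : nat -> R) K k (H : R) : (k < K)%N ->
  0 <= h k <= H -> 0 <= g k <= H ->
  `|h k - g k| <= 2 * Num.sqrt H *
    Num.sqrt (\sum_(x < K) (Num.sqrt (h x) - Num.sqrt (g x)) ^+ 2).
Proof.
move=> kK /andP[h0 hH] /andP[g0 gH].
rewrite -{1}(sqr_sqrtr h0) -{1}(sqr_sqrtr g0) subr_sqr normrM mulrC.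
apply: ler_pM => //.
- rewrite ger0_norm ?addr_ge0 ?sqrtr_ge0//.
  by rewrite mulr_natl mulr2n lerD// ler_wsqrtr.
- rewrite -sqrtr_sqr ler_wsqrtr// (bigD1 (Ordinal kK))//= lerDl.
  by apply: sumr_ge0 => i _; exact: sqr_ge0.
Qed.

Section two_mixtures.
Variables (Q Q' : probability R R) (M : nat).
Hypotheses (QI : supported_on th Q) (QI' : supported_on th Q').

Let D : R := \sum_(x < 3 * M) (Num.sqrt (hpois th Q x) - Num.sqrt (hpois th Q' x)) ^+ 2.
Let W : R := th / s.
Let B : R := 2 * W + W ^+ 2.
Let rr : R := Num.max 1 (2 * Num.sqrt th / s).

Let W0 : 0 <= W. Proof. by rewrite divr_ge0 ?ltW. Qed.
Let rr1 : 1 <= rr. Proof. by rewrite le_max lexx. Qed.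

Let zexp x := expR (zof x ^+ 2 / 4).

Let rho x : R := amp x * (zexp x * (2 * expR (3 * W ^+ 2) * (B ^+ M / Num.sqrt M`!%:R))).

Let kernel_error x t : 0 <= t <= th ->
  `|normal_pdf t s x - \sum_(p : 'I_M * 'I_M) amp x * coef (zof x) p * pois t (p.1 + p.2.*2)| <= rho x.
Proof.
move=> /andP[t0 tth].
under eq_bigr do rewrite -mulrA.
rewrite -mulr_sumr -trunc_pois kernel_factor -mulrBr -mulrBr normrM.
rewrite (ger0_norm (amp_ge0 x)) normrM (ger0_norm (expR_ge0 (- t))) /rho ler_wpM2l//.
have w0 : 0 <= t / s by rewrite divr_ge0 // ltW.
have wW : t / s <= W by rewrite /W ler_pM2r ?invr_gt0.
apply: (@le_trans _ _ (1 * `|expR (zof x * (t / s)) * expR (- ((t / s) ^+ 2 / 2)) -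
   exp_trunc M (zof x * (t / s)) * exp_trunc M (- ((t / s) ^+ 2 / 2))|)).
  by rewrite ler_wpM2r// -[leRHS]expR0 ler_expR oppr_le0.
rewrite mul1r; apply: (le_trans (exp_product_trunc_error _ _ _)).
move: (t / s) w0 wW => w w0 wW.
rewrite normrN normrM (ger0_norm w0) (ger0_norm (_ : 0 <= w ^+ 2 / 2)); last first.
  by rewrite divr_ge0 ?sqr_ge0.
rewrite /zexp; move: (zof x) => z.
set F := M`!%:R : R.
have F0 : 0 < F by rewrite ltr0n fact_gt0.
have e8 : 1 <= expR (z ^+ 2 / 8) by rewrite -[leLHS]expR0 ler_expR divr_ge0 ?sqr_ge0.
have sF1 : 1 <= Num.sqrt F.
  by rewrite -[leLHS]sqrtr1 ler_wsqrtr// ler1n fact_gt0.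
have W20 : 0 <= W ^+ 2 by exact: sqr_ge0.
have W2B : 2 * W <= B by rewrite /B lerDl.
have WB : W ^+ 2 <= B by rewrite /B lerDr mulr_ge0.
have W20' : 0 <= 2 * W by rewrite mulr_ge0.
have B0 : 0 <= B by exact: le_trans W2B.
have w2W2 : w ^+ 2 <= W ^+ 2 by rewrite lerXn2r ?nnegrE.
have b1 : (`|z| * w) ^+ M + (w ^+ 2 / 2) ^+ M <= 2 * B ^+ M * (Num.sqrt F * expR (z ^+ 2 / 8)).
  have -> : 2 * B ^+ M * (Num.sqrt F * expR (z ^+ 2 / 8)) =
    B ^+ M * (Num.sqrt F * expR (z ^+ 2 / 8)) + B ^+ M * (Num.sqrt F * expR (z ^+ 2 / 8)) by ring.
  apply: lerD.
    rewrite exprMn.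
    apply: (le_trans (ler_pM _ _ (norm_expr_le_sqrt_fact4 M z) (lerXn2r M _ _ wW))); rewrite ?exprn_ge0 ?nnegrE//.
    have -> : 2 ^+ M * Num.sqrt F * expR (z ^+ 2 / 8) * W ^+ M =
      (2 * W) ^+ M * (Num.sqrt F * expR (z ^+ 2 / 8)) by rewrite [(2 * W) ^+ M]exprMn; ring.
    rewrite ler_wpM2r ?mulr_ge0 ?sqrtr_ge0 ?expR_ge0//.
    by apply: lerXn2r; rewrite ?nnegrE.
  rewrite -[leLHS]mulr1; apply: ler_pM => //.
  - by rewrite exprn_ge0// divr_ge0 ?sqr_ge0.
  - apply: lerXn2r; rewrite ?nnegrE ?divr_ge0 ?sqr_ge0//.
    by have := sqr_ge0 w; lra.
  - by rewrite -[leLHS]mulr1; apply: ler_pM.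
(* From [|z| * W <= z ^ 2 / 8 + 2 * W ^ 2], an AM-GM step; the 3 leaves room for [w ^ 2 / 2]. *)
have b2 : expR (`|z| * w) * expR (w ^+ 2 / 2) <= expR (z ^+ 2 / 8) * expR (3 * W ^+ 2).
  rewrite -!expRD ler_expR.
  have zW : `|z| * w <= `|z| * W by rewrite ler_wpM2l.
  have : 0 <= (`|z| / 2 - 2 * W) ^+ 2 by exact: sqr_ge0.
  have : `|z| ^+ 2 = z ^+ 2 by rewrite real_normK ?num_real.
  by move: W20 w2W2 zW; rewrite !expr2; lra.
have -> : z ^+ 2 / 4 = z ^+ 2 / 8 + z ^+ 2 / 8 by field.
rewrite expRD.
apply: (le_trans (ler_pM _ _ (ler_wpM2r _ b1) b2)).
- by rewrite divr_ge0 ?ler0n// addr_ge0 ?exprn_ge0 ?divr_ge0 ?mulr_ge0 ?sqr_ge0.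
- by rewrite mulr_ge0 ?expR_ge0.
- by rewrite invr_ge0 ler0n.
have {2}<- : Num.sqrt F ^+ 2 = F by rewrite sqr_sqrtr ?ltW.
have sF0 : Num.sqrt F != 0 by rewrite gt_eqF// (lt_le_trans ltr01).
rewrite le_eqVlt; apply/orP; left; apply/eqP.
move: (Num.sqrt F) sF0 => f f0.
by move: (expR _) (expR _) => e1 e2; field.
Qed.

(** The factorials cancel here through [sqrt_fact_weight_le], leaving the [k]-th power of
    [2 sqrt th / s] with [k < 3 * M]. Taking the maximum with 1 in [rr] makes the power monotone in
    the exponent. *)
Let coef_bound x (p : 'I_M * 'I_M) :
  `|amp x * coef (zof x) p| * `|hpois th Q (p.1 + p.2.*2) - hpois th Q' (p.1 + p.2.*2)| <=
  amp x * (zexp x * (2 * Num.sqrt D * rr ^+ (3 * M))).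
Proof.
case: p => a j /=; set k := (a + j.*2)%N.
have kM : (k < 3 * M)%N.
  rewrite /k; have := ltn_ord a; have := ltn_ord j; rewrite -muln2; lia.
rewrite normrM (ger0_norm (amp_ge0 x)) -[leLHS]mulrA ler_wpM2l//.
have dh := sqrt_diff_le kM (H := th ^+ k / k`!%:R) (h := hpois th Q) (g := hpois th Q').
rewrite !hpois_ge0 ?hpois_le// in dh.
have {}dh := dh isT isT; rewrite -/D in dh.
apply: (le_trans (ler_wpM2l (normr_ge0 _) dh)).
rewrite /coef /= -/k normrM normfV !normrM !normrX normrN1 expr1n mulr1.
rewrite !(ger0_norm (ler0n _ _)) (gtr0_norm s_gt0).
have wt := sqrt_fact_weight_le a j (zof x); rewrite -/k -/(zexp x) in wt.
rewrite sqrtrM ?(exprn_ge0 _ (ltW th_gt0))// sqrtrV ?ler0n//.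
have k0 : 0 < Num.sqrt k`!%:R :> R by rewrite sqrtr_gt0 ltr0n fact_gt0.
have kk : k`!%:R = Num.sqrt k`!%:R * Num.sqrt k`!%:R :> R by rewrite -expr2 sqr_sqrtr ?ler0n.
have -> : Num.sqrt (th ^+ k) = Num.sqrt th ^+ k.
  by elim: k {kM dh wt k0 kk} => [|m IH]; rewrite ?expr0 ?sqrtr1// !exprS sqrtrM ?IH ?ltW.
have r0 : 0 <= 2 * Num.sqrt th / s by rewrite divr_ge0 ?mulr_ge0 ?sqrtr_ge0 ?ltW.
have rk : (2 * Num.sqrt th / s) ^+ k <= rr ^+ (3 * M).
  apply: (@le_trans _ _ (rr ^+ k)); last by rewrite ler_weXn2l// ltnW.
  by rewrite lerXn2r ?nnegrE// ?(le_trans ler01)// le_max lexx orbT.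
set wz := (X in X <= _) in wt.
have -> : `|zof x| ^+ a * k`!%:R / (a`!%:R * j`!%:R * 2 ^+ j * s ^+ k) *
    (2 * (Num.sqrt th ^+ k / Num.sqrt k`!%:R) * Num.sqrt D) =
    wz * (Num.sqrt th ^+ k / s ^+ k) * (2 * Num.sqrt D).
  rewrite {1}kk /wz.
  have A0 : a`!%:R != 0 :> R by rewrite pnatr_eq0 -lt0n fact_gt0.
  have J0 : j`!%:R != 0 :> R by rewrite pnatr_eq0 -lt0n fact_gt0.
  have S0 : s ^+ k != 0 by rewrite expf_neq0.
  have T0 : 2 ^+ j != 0 :> R by rewrite expf_neq0.
  have : Num.sqrt k`!%:R != 0 :> R by rewrite gt_eqF.
  move: (Num.sqrt k`!%:R : R) (Num.sqrt D) (Num.sqrt th ^+ k) (`|zof x| ^+ a) => u v p q u0.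
  move: (a`!%:R : R) (j`!%:R : R) (s ^+ k) (2 ^+ j : R) A0 J0 S0 T0 => A J S T A0 J0 S0 T0.
  by field; rewrite A0 J0 S0 T0 u0.
rewrite [leRHS](_ : _ = zexp x * rr ^+ (3 * M) * (2 * Num.sqrt D)); last by ring.
rewrite ler_wpM2r ?mulr_ge0 ?sqrtr_ge0//.
have q0 : 0 <= Num.sqrt th ^+ k / s ^+ k.
  by apply: divr_ge0; apply: exprn_ge0; rewrite ?sqrtr_ge0// ltW.
apply: (le_trans (ler_wpM2r q0 wt)).
rewrite [leLHS](_ : _ = zexp x * (2 * Num.sqrt th / s) ^+ k).
  by rewrite ler_wpM2l ?expR_ge0.
by rewrite exprMn exprMn exprVn; ring.
Qed.

(* For [M = 0] the first term vanishes and this is a bound uniform in [Q] and [Q']. *)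
Lemma mixture_pdf_diff_le x :
  `|mixture_pdf s Q x - mixture_pdf s Q' x| <=
  normal_peak s * expR (- ((x / s) ^+ 2 / 2)) * expR ((x / s + s) ^+ 2 / 4) *
  (2 * Num.sqrt D * M%:R ^+ 2 * rr ^+ (3 * M) +
   4 * expR (3 * W ^+ 2) * (B ^+ M / Num.sqrt M`!%:R)).
Proof.
rewrite -/(amp x) -/(zof x) -/(zexp x).
have approx (P : probability R R) : supported_on th P ->
    `|mixture_pdf s P x - \sum_(p : 'I_M * 'I_M) amp x * coef (zof x) p * hpois th P (p.1 + p.2.*2)|
      <= rho x.
  move=> PI; rewrite (mixture_pdf_Rintegral PI)//.
  apply: (mean_approx PI (k := fun p : 'I_M * 'I_M => (p.1 + p.2.*2)%N) (B := normal_peak s)).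
  - exact: (measurableT_comp (measurable_normal_pdf2 s_gt0) (measurable_pair2 x)).
  - by move=> t; rewrite ger0_norm ?normal_pdf_ge0// normal_pdf_ub.
  - exact: kernel_error.
have := approx _ QI; have := approx _ QI'.
set SQ' := \sum_p _; set SQ := \sum_p _.
have : `|SQ - SQ'| <= amp x * (zexp x * (2 * Num.sqrt D * M%:R ^+ 2 * rr ^+ (3 * M))).
  rewrite /SQ /SQ' -sumrB; apply: (le_trans (ler_norm_sum _ _ _)).
  apply: (@le_trans _ _ (\sum_(p : 'I_M * 'I_M) amp x * (zexp x * (2 * Num.sqrt D * rr ^+ (3 * M))))).
    by apply: ler_sum => p _; rewrite -mulrBr normrM coef_bound.
  rewrite sumr_const card_prod card_ord -[_ *+ _]mulr_natl natrM.
  by rewrite le_eqVlt; apply/orP; left; apply/eqP; ring.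
rewrite /rho; move: (mixture_pdf s Q x) (mixture_pdf s Q' x) => p p' h1 h2 h3.
have -> : p - p' = (p - SQ) + (SQ - SQ') - (p' - SQ') by ring.
apply: (le_trans (ler_normB _ _)); apply: (le_trans (lerD (ler_normD _ _) (lexx _))).
apply: (le_trans (lerD (lerD h3 h1) h2)).
by rewrite le_eqVlt; apply/orP; left; apply/eqP; ring.
Qed.
End two_mixtures.
End pointwise_density_bound.

(** * Rates *)

(* [measurableTypeR R], which carries [lebesgue_measure], and [R] itself have the same measurable sets
   but distinct displays; the identity transports the measure. *)
Lemma W1_le_weighted_TV_lebesgue (R : realType) (p q : R -> R) (P Q : set R -> \bar R) :
  measurable_fun setT p -> measurable_fun setT q ->
  (forall x, 0 <= p x) -> (forall x, 0 <= q x) ->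
  (\int[@lebesgue_measure R]_x (p x)%:E = 1)%E -> (\int[@lebesgue_measure R]_x (q x)%:E = 1)%E ->
  (forall A, measurable A -> P A = \int[@lebesgue_measure R]_(x in A) (p x)%:E)%E ->
  (forall A, measurable A -> Q A = \int[@lebesgue_measure R]_(x in A) (q x)%:E)%E ->
  (W1 P Q <= \int[@lebesgue_measure R]_x (`|x| * `|p x - q x|)%:E)%E.
Proof.
move=> mp mq p0 q0 p1 q1 PE QE.
have mid : measurable_fun setT (id : measurableTypeR R -> R).
  by move=> _ A mA; rewrite setTI.
pose lam : {measure set R -> \bar R} :=
  ltac:(refine (pushforward (@lebesgue_measure R) (id : measurableTypeR R -> R) : {measure set R -> \bar R}); exact: mid).
have lamE (A : set R) (f : R -> R) : measurable A -> measurable_fun setT f -> (forall x, 0 <= f x) ->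
    (\int[lam]_(x in A) (f x)%:E = \int[@lebesgue_measure R]_(x in A) (f x)%:E)%E.
  move=> mA mf f0; apply: (ge0_integral_pushforward mid) => //.
  - by apply/measurable_EFinP; exact: measurable_funTS.
  - by move=> x _; rewrite lee_fin.
rewrite -lamE//; last first.
  apply: measurable_funM; first exact: normr_measurable.
  by apply: measurableT_comp => //; exact: measurable_funB.
apply: W1_le_weighted_TV => //.
- by rewrite lamE.
- by rewrite lamE.
- by move=> A mA; rewrite lamE// PE.
- by move=> A mA; rewrite lamE// QE.
Qed.

Section smoothed_W1_bound.
Context {R : realType} (th s : R).
Hypotheses (th_gt0 : 0 < th) (s_gt0 : 0 < s).
Local Notation mu := (@lebesgue_measure R).

Definition smoothing_cst : R := normal_peak s * s * expR (5 / 4 * s ^+ 2 + 4) / normal_peak (2 * s).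

Lemma smoothing_cst_ge0 : 0 <= smoothing_cst.
Proof.
apply: divr_ge0; last exact: normal_peak_ge0.
by rewrite mulr_ge0 ?expR_ge0// mulr_ge0 ?normal_peak_ge0// ltW.
Qed.

(** With [u = x / s], use [|u| <= expR |u|], [|u| <= u ^ 2 / 16 + 4] and
    [u * s / 2 <= u ^ 2 / 16 + s ^ 2]. The exponent is then at most
    [- u ^ 2 / 8 + 5 / 4 * s ^ 2 + 4], a Gaussian of standard deviation [2 * s]. *)
Lemma weighted_kernel_le x :
  `|x| * (normal_peak s * expR (- ((x / s) ^+ 2 / 2)) * expR ((x / s + s) ^+ 2 / 4)) <=
  smoothing_cst * normal_pdf 0 (2 * s) x.
Proof.
have s0 : s != 0 by rewrite gt_eqF.
have s20 : 2 * s != 0 by rewrite mulf_neq0.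
have pk : normal_peak (2 * s) != 0 by rewrite gt_eqF// normal_peak_gt0.
rewrite normal_pdfE// /smoothing_cst.
rewrite [leRHS](_ : _ = normal_peak s * (s * (expR (5 / 4 * s ^+ 2 + 4) * normal_fun 0 (2 * s) x))); last first.
  by move: (expR _) (normal_fun _ _ _) => e f; field.
rewrite [leLHS](_ : _ = normal_peak s * (`|x| * (expR (- ((x / s) ^+ 2 / 2)) * expR ((x / s + s) ^+ 2 / 4)))); last by ring.
rewrite ler_wpM2l ?normal_peak_ge0//.
pose u := x / s; have xE : `|x| = s * `|u|.
  by rewrite /u normrM normfV (gtr0_norm s_gt0); field.
rewrite xE -/u -[leLHS]mulrA ler_wpM2l ?(ltW s_gt0)//.
have -> : normal_fun 0 (2 * s) x = expR (- (u ^+ 2 / 8)).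
  by rewrite /normal_fun -mulr_natr /u; congr expR; field.
have u_exp : `|u| <= expR `|u|.
  by rewrite (le_trans _ (expR_ge1Dx _))// lerDr.
apply: (le_trans (ler_wpM2r _ u_exp)); first by rewrite mulr_ge0 ?expR_ge0.
rewrite -!expRD ler_expR.
have uu : `|u| ^+ 2 = u ^+ 2 by rewrite real_normK ?num_real.
have h1 := sqr_ge0 (`|u| / 4 - 2); have h2 := sqr_ge0 (u / 4 - s).
have e1 : (`|u| / 4 - 2) ^+ 2 = u ^+ 2 / 16 - `|u| + 4 by rewrite -uu; field.
have e2 : (u / 4 - s) ^+ 2 = u ^+ 2 / 16 - u * s / 2 + s ^+ 2 by field.
have e3 : (u + s) ^+ 2 = u ^+ 2 + 2 * (u * s) + s ^+ 2 by ring.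
by rewrite e1 in h1; rewrite e2 in h2; rewrite e3; lra.
Qed.

Lemma W1s_le (Q Q' : probability R R) M : supported_on th Q -> supported_on th Q' ->
  (W1s s Q Q' <= (smoothing_cst *
    (2 * Num.sqrt (\sum_(x < 3 * M) (Num.sqrt (hpois th Q x) - Num.sqrt (hpois th Q' x)) ^+ 2) *
       M%:R ^+ 2 * Num.max 1 (2 * Num.sqrt th / s) ^+ (3 * M) +
     4 * expR (3 * (th / s) ^+ 2) *
       ((2 * (th / s) + (th / s) ^+ 2) ^+ M / Num.sqrt M`!%:R)))%:E)%E.
Proof.
move=> QI QI'; set T := (X in (smoothing_cst * X)%:E).
have T0 : 0 <= T.
  apply: addr_ge0; apply: mulr_ge0.
  - by rewrite !mulr_ge0 ?sqrtr_ge0 ?exprn_ge0 ?ler0n.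
  - by rewrite exprn_ge0// le_max ler01.
  - by rewrite mulr_ge0 ?expR_ge0.
  - rewrite divr_ge0 ?sqrtr_ge0// exprn_ge0// addr_ge0 ?sqr_ge0// mulr_ge0//.
    by rewrite divr_ge0 ?ltW.
have mp := measurable_mixture_pdf s_gt0 Q.
have mq := measurable_mixture_pdf s_gt0 Q'.
apply: (@le_trans _ _ (\int[mu]_x (`|x| * `|mixture_pdf s Q x - mixture_pdf s Q' x|)%:E)%E).
  apply: W1_le_weighted_TV_lebesgue => //.
  - exact: mixture_pdf_ge0.
  - exact: mixture_pdf_ge0.
  - exact: integral_mixture_pdf.
  - exact: integral_mixture_pdf.
  - by move=> A mA; exact: gauss_conv_density.
  - by move=> A mA; exact: gauss_conv_density.
apply: (@le_trans _ _ (\int[mu]_x ((smoothing_cst * T)%:E * (normal_pdf 0 (2 * s) x)%:E))%E).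
  apply: ge0_le_integral => //.
  - apply/measurable_EFinP; apply: measurable_funM; first exact: normr_measurable.
    by apply: measurableT_comp => //; exact: measurable_funB.
  - by apply/measurable_EFinP/measurable_funM => //; exact: measurable_normal_pdf.
  - move=> x _; rewrite -EFinM lee_fin.
    have := mixture_pdf_diff_le th_gt0 s_gt0 M QI QI' x.
    rewrite -/T => h; apply: (le_trans (ler_wpM2l (normr_ge0 x) h)).
    by rewrite mulrA [leRHS]mulrAC ler_wpM2r// weighted_kernel_le.
rewrite ge0_integralZl//.
- by rewrite integral_normal_pdf mule1.
- by apply/measurable_EFinP; exact: measurable_normal_pdf.
- by move=> x _; rewrite lee_fin normal_pdf_ge0.
- by rewrite lee_fin mulr_ge0// smoothing_cst_ge0.
Qed.
End smoothed_W1_bound.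

(** * Choice of the truncation level *)

Section truncation_level.
Context {R : realType}.

(* At this level [trunc_level n]! eventually exceeds [b ^ trunc_level n * n] for every [b], while
   [r ^ trunc_level n] stays below [n ^ (4 * ln r / ln (ln n))]. *)
Definition trunc_level (n : nat) : nat := Num.truncn (4 * ln n%:R / ln (ln n%:R) : R).

Lemma ln_le_sub1 (x : R) : 0 < x -> ln x <= x - 1.
Proof. by move=> x0; rewrite lerBrDr addrC -[leRHS](lnK x0) expR_ge1Dx. Qed.

Lemma lnln_eventually_ge (v : R) : exists N, forall n, (N <= n)%N ->
  1 < n%:R :> R /\ v <= ln (ln n%:R) :> R /\ 0 < ln n%:R :> R.
Proof.
exists (Num.truncn (expR (expR v))).+1 => n Nn.
have nv : expR (expR v) <= n%:R.
  have := truncnS_gt (expR (expR v)); move/ltW => /le_trans; apply.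
  by rewrite ler_nat.
have n0 : 0 < n%:R :> R by exact: lt_le_trans (expR_gt0 _) nv.
have Lv : expR v <= ln n%:R by rewrite -ler_expR lnK.
have L0 : 0 < ln n%:R :> R by exact: lt_le_trans (expR_gt0 _) Lv.
split; last by split=> //; rewrite -ler_expR lnK.
by apply: lt_le_trans nv; rewrite -[ltLHS]expR0 ltr_expR expR_gt0.
Qed.

(** Since [M! >= (M / e) ^ M], it suffices that [M * (ln M - 1 - ln b) >= L]. This follows from
    [M >= 3 * L / l] and [ln M >= l / 2] once [l >= 6 * (1 + ln b)]; the 4 in the hypothesis absorbs
    the rounding. *)
Lemma fact_lower_bound (b L : R) (M : nat) : 1 <= b -> 0 < L -> 1 + 6 * (1 + ln b) <= ln L ->
  4 * (L / ln L) < M%:R + 1 -> (0 < M)%N /\ b ^+ M * expR L <= M`!%:R.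
Proof.
move=> b1 L0 ll M_gt.
have b0 : 0 < b by exact: lt_le_trans b1.
have lb0 : 0 <= ln b by exact: ln_ge0.
set l := ln L in ll M_gt *.
have l1 : 1 <= l by lra.
have l0 : 0 < l by exact: lt_le_trans l1.
have lL : l <= L by have := ln_le_sub1 L0; rewrite -/l; lra.
have Ll : 1 <= L / l by rewrite ler_pdivlMr// mul1r.
have M3 : 3 * (L / l) <= M%:R by lra.
have M0R : 0 < M%:R :> R by lra.
have M0 : (0 < M)%N by rewrite -(ltr0n R).
have lnM : l / 2 <= ln M%:R.
  have sL : 0 < Num.sqrt L by rewrite sqrtr_gt0.
  have LE : L = Num.sqrt L * Num.sqrt L by rewrite -expr2 sqr_sqrtr ?ltW.
  have lE : l = 2 * ln (Num.sqrt L).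
    by rewrite /l {1}LE lnM ?posrE//; lra.
  have l2 : ln (Num.sqrt L) <= Num.sqrt L - 1 by exact: ln_le_sub1.
  have -> : l / 2 = ln (Num.sqrt L) by rewrite lE; field.
  rewrite ler_ln ?posrE// (le_trans _ M3)//.
  rewrite mulrA ler_pdivlMr// {2}LE mulrCA ler_wpM2l ?sqrtr_ge0//.
  by rewrite lE; lra.
split=> //.
have Mfact : M%:R ^+ M <= M`!%:R * expR M%:R :> R.
  have := @expr_fact_le_expR R M M%:R (ler0n _ _).
  by rewrite ler_pdivrMr ?ltr0n ?fact_gt0// mulrC.
move: (M`!%:R : R) Mfact => F Mfact.
rewrite -(ler_pM2r (expR_gt0 M%:R)); apply: le_trans Mfact.
have powE (y : R) : 0 < y -> y ^+ M = expR (M%:R * ln y).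
  by move=> y0; rewrite expRM_natl lnK.
rewrite !powE// -!expRD ler_expR.
have key : L <= M%:R * (ln M%:R - (1 + ln b)).
  apply: (@le_trans _ _ (3 * (L / l) * (l / 2 - (1 + ln b)))).
    have -> : 3 * (L / l) * (l / 2 - (1 + ln b)) = L + L * ((l - 6 * (1 + ln b)) / (2 * l)).
      by field; rewrite gt_eqF.
    rewrite lerDl; apply: mulr_ge0; first exact: ltW.
    by apply: divr_ge0; lra.
  by apply: ler_pM; lra.
by move: key; rewrite mulrBr mulrDr mulr1; lra.
Qed.

Lemma trunc_level_spec (b : R) : 1 <= b -> exists N, forall n, (N <= n)%N ->
  [/\ 1 < n%:R :> R, 1 <= ln (ln n%:R) :> R, (0 < trunc_level n)%N,
    (trunc_level n)%:R <= 4 * ln n%:R / ln (ln n%:R) :> R &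
    b ^+ trunc_level n * n%:R <= (trunc_level n)`!%:R].
Proof.
move=> b1; have lb0 : 0 <= ln b by exact: ln_ge0.
have [N HN] := lnln_eventually_ge (1 + 6 * (1 + ln b)).
exists N => n /HN[n1 [ll L0]].
have n0 : 0 < n%:R :> R by exact: lt_trans n1.
have l1 : 1 <= ln (ln n%:R) :> R by lra.
have /andP[M_le M_gt] : (trunc_level n)%:R <= (4 * ln n%:R / ln (ln n%:R) : R) < (trunc_level n).+1%:R.
  by apply: truncn_itv; rewrite divr_ge0 ?mulr_ge0//; lra.
move: (trunc_level n) M_le M_gt => M M_le M_gt.
have [] := fact_lower_bound (M := M) b1 L0 ll; first by rewrite mulrA natr1.
by rewrite lnK.
Qed.
End truncation_level.

(** * Assembling the risk bound *)

Section risk_bound.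
Context {R : realType} (th s : R).
Hypotheses (th_gt0 : 0 < th) (s_gt0 : 0 < s).
Variable Qhat : forall n, ('I_n -> nat) -> probability R R.
Hypothesis MLE : is_NPMLE th Qhat.

Let C : R := smoothing_cst s.
Let C0 : 0 <= C. Proof. exact: smoothing_cst_ge0. Qed.
Let rr : R := Num.max 1 (2 * Num.sqrt th / s).
Let rr1 : 1 <= rr. Proof. by rewrite le_max lexx. Qed.
Let E0 : R := 4 * expR (3 * (th / s) ^+ 2).
Let E00 : 0 <= E0. Proof. by rewrite mulr_ge0 ?expR_ge0. Qed.
Let B : R := 2 * (th / s) + (th / s) ^+ 2.
Let B0 : 0 <= B.
Proof.
have W0 : 0 <= th / s by rewrite divr_ge0 ?ltW.
by rewrite addr_ge0 ?sqr_ge0// mulr_ge0.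
Qed.

Lemma W1s_ge0 (Q Q' : probability R R) : (0 <= W1s s Q Q')%E.
Proof.
apply: le_ereal_inf_tmp => _ [pi _ <-].
by apply: integral_ge0 => z _; rewrite lee_fin.
Qed.

Section fixed_sample_size.
Variables (n M : nat) (Q : probability R R).
Hypotheses (n_gt0 : (0 < n)%N) (M_gt0 : (0 < M)%N) (QI : supported_on th Q).

Let K := (3 * M).-1.
Let KE : K.+1 = (3 * M)%N. Proof. by rewrite prednK// muln_gt0. Qed.
Let h := hpois th Q.
Let h0 x : 0 <= h x. Proof. exact: hpois_ge0. Qed.
Let q : R := Num.sqrt n%:R.
Let q0 : 0 < q. Proof. by rewrite sqrtr_gt0 ltr0n. Qed.
Let G : R := M%:R ^+ 2 * rr ^+ (3 * M).
Let G0 : 0 <= G.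
Proof. by rewrite mulr_ge0 ?exprn_ge0 ?ler0n// (le_trans ler01). Qed.
Let eps : R := B ^+ M / Num.sqrt M`!%:R.
Let eps0 : 0 <= eps. Proof. by rewrite divr_ge0 ?exprn_ge0 ?sqrtr_ge0. Qed.
Let chi (X : 'I_n -> nat) : R :=
  \sum_(x < K.+1) ((\sum_(i < n) (X i == x)%:R) / n%:R - h x) ^+ 2 / h x.
Let tau : R := 1 - \sum_(x < K.+1) h x.
Let tau0 : 0 <= tau. Proof. by rewrite subr_ge0; exact: (sum_hpois_le1 QI). Qed.

Let W1s_const (X : 'I_n -> nat) : (W1s s Q (Qhat X) <= (C * E0)%:E)%E.
Proof.
have := W1s_le th_gt0 s_gt0 0 QI (MLE X).1; move=> /le_trans; apply.
by rewrite lee_fin !(expr0, mulr0, mulr1, mul1r, fact0, sqrtr1, divr1, add0r, expr0n).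
Qed.

Let W1s_chi (X : 'I_n -> nat) : (forall i, 0 < h (X i)) -> (forall i, (X i <= K)%N) ->
  (W1s s Q (Qhat X) <=
    (C * (G * (4 * q)) * chi X + C * (G * (4 * q * tau + q^-1) + E0 * eps))%:E)%E.
Proof.
move=> hX XK; have [QhI Qhmax] := MLE X.
apply: (le_trans (W1s_le th_gt0 s_gt0 M QI QhI)).
rewrite lee_fin -/C -/rr -/E0 -/B -/eps -KE -/h.
set g := hpois th (Qhat X).
set D := \sum_(x < K.+1) _.
have Dle : D <= 4 * chi X + 4 * tau.
  pose X' (i : 'I_n) : 'I_K.+1 := inord (X i).
  have X'E i : X' i = X i :> nat by rewrite inordK// ltnS.
  have -> : chi X = \sum_(x < K.+1) ((\sum_(i < n) (X' i == x)%:R) / n%:R - h x) ^+ 2 / h x.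
    apply: eq_bigr => x _; congr ((_ / _ - _) ^+ 2 / _); apply: eq_bigr => i _.
    by rewrite -val_eqE /= X'E.
  apply: (@hellinger_mle R K.+1 n h g X') => //.
  - by move=> x; exact: hpois_ge0.
  - exact: (sum_hpois_le1 QI).
  - exact: (sum_hpois_le1 QhI).
  - by move=> i; rewrite X'E.
  - under eq_bigr do rewrite X'E.
    under [leRHS]eq_bigr do rewrite X'E.
    exact: Qhmax.
(* The root is linearised around the expected size [1 / n] of [D]; the bound becomes affine in
   [chi], so its expectation can be taken directly. *)
have sD : 2 * Num.sqrt D <= q * D + q^-1.
  have D0 : 0 <= D by apply: sumr_ge0 => x _; exact: sqr_ge0.
  rewrite -{2}(sqr_sqrtr D0); move: (Num.sqrt D) => d.
  rewrite -subr_ge0 (_ : _ - _ = q^-1 * (q * d - 1) ^+ 2); last by field; rewrite gt_eqF.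
  by rewrite mulr_ge0 ?sqr_ge0// invr_ge0 ltW.
rewrite [leRHS](_ : _ = C * (G * (q * (4 * chi X + 4 * tau) + q^-1) + E0 * eps)); last by ring.
rewrite ler_wpM2l// lerD2r -[leLHS]mulrA KE -/G mulrC ler_wpM2l//.
by apply: (le_trans sD); rewrite lerD2r ler_wpM2l// ltW.
Qed.

Lemma risk_le : 1 - \sum_(x < 3 * M) hpois th Q x <= (n%:R ^+ 2)^-1 ->
    B ^+ M / Num.sqrt M`!%:R <= (Num.sqrt n%:R)^-1 ->
  (risk th s Qhat n Q <= (C * (21 + 2 * E0) * M%:R ^+ 3 * rr ^+ (3 * M) * q^-1)%:E)%E.
Proof.
rewrite -/eps -/q => tau_le' eps_le.
have tau_le : tau <= (n%:R ^+ 2)^-1 by rewrite /tau KE.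
have a0 : 0 <= C * (G * (4 * q)) by exact: mulr_ge0 C0 (mulr_ge0 G0 (mulr_ge0 _ (ltW q0))).
have b0 : 0 <= C * (G * (4 * q * tau + q^-1) + E0 * eps).
  apply: (mulr_ge0 C0); apply: addr_ge0; last exact: mulr_ge0.
  by apply: (mulr_ge0 G0); rewrite addr_ge0 ?invr_ge0 ?(ltW q0)// mulr_ge0// mulr_ge0// ltW.
have c0 : 0 <= C * E0 by rewrite mulr_ge0.
apply: (le_trans (@expected_risk_le R n K h h0 (fun N => sum_hpois_le1 QI N)
  (fun X => W1s s Q (Qhat X)) _ _ _ n_gt0 a0 b0 c0 (fun X => W1s_ge0 _ _)
  (fun X _ => W1s_const X) W1s_chi)).
rewrite lee_fin -/tau KE natrM.
have nq : n%:R = q ^+ 2 :> R by rewrite sqr_sqrtr ?ler0n.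
have q1 : 1 <= q by rewrite -[leLHS]sqrtr1 ler_wsqrtr// ler1n.
have M1 : 1 <= M%:R :> R by rewrite ler1n.
set v := q^-1 in eps_le *.
have v0 : 0 <= v by rewrite invr_ge0 ltW.
have qv : q * v = 1 by rewrite divff// gt_eqF.
have v1 : v <= 1 by rewrite invf_le1.
have tau_le4 : tau <= v ^+ 4 by rewrite (le_trans tau_le)// nq /v exprVn -exprM.
have q2tau : q ^+ 2 * tau <= v.
  apply: (le_trans (ler_wpM2l (sqr_ge0 q) tau_le4)).
  rewrite [leLHS](_ : _ = (q * v) ^+ 2 * v * v); last by ring.
  by rewrite qv expr1n mul1r ler_piMl.
have qtau : q * tau <= v.
  by apply: le_trans q2tau; rewrite ler_wpM2r// expr2 ler_peMl// (ltW q0).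
have rM1 : 1 <= rr ^+ (3 * M) by exact: exprn_ege1.
have G1 : 1 <= G by rewrite -[leLHS]mulr1; apply: ler_pM => //; exact: exprn_ege1.
have GM : G <= G * M%:R by rewrite ler_peMr.
have GM1 : 1 <= G * M%:R by exact: le_trans GM.
rewrite nq (_ : (q ^+ 2)^-1 = v * v); last by rewrite /v -invfM.
rewrite [leLHS](_ : _ = C * (G * (12 * M%:R * v * (q * v) + 4 * (q * tau)) +
  G * (4 * (q * tau) + v) + E0 * eps + E0 * (q ^+ 2 * tau))); last first.
  by ring.
rewrite qv mulr1 [leRHS](_ : _ = C * ((21 + 2 * E0) * (G * M%:R) * v)); last by rewrite /G; ring.
rewrite ler_wpM2l//.
have h1 : G * (12 * M%:R * v + 4 * (q * tau)) <= G * (12 * M%:R * v + 4 * v) by rewrite ler_wpM2l//; lra.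
have h2 : G * (4 * (q * tau) + v) <= G * (4 * v + v) by rewrite ler_wpM2l//; lra.
have h3 : E0 * eps <= E0 * v by rewrite ler_wpM2l.
have h4 : E0 * (q ^+ 2 * tau) <= E0 * v by rewrite ler_wpM2l.
have h5 : G * v <= G * M%:R * v by rewrite ler_wpM2r.
have h6 : E0 * v <= E0 * v * (G * M%:R) by rewrite ler_peMr// mulr_ge0.
(* The constant is [21 = 12 + 4 + 5]: 12 from [4 * 3 M] cells, 4 from the missing mass in the
   expected chi-square, [4 + 1] from [Dle] and [sD]. The two [E0] come from the kernel remainder and
   the samples out of range. *)
move: h1 h2 h3 h4 h5 h6; lra.
Qed.
End fixed_sample_size.

(** Cubing the hypothesis on [M!] and using [M! ^ 3 <= (3 * M)!] gives even
    [b ^ (3 * M) * n ^ 3 <= (3 * M)!]. *)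
Lemma tail_level_le (b : R) (n M : nat) (Q : probability R R) :
  1 <= b -> th <= b -> (0 < n)%N -> b ^+ M * n%:R <= M`!%:R -> supported_on th Q ->
  1 - \sum_(x < 3 * M) hpois th Q x <= (n%:R ^+ 2)^-1.
Proof.
move=> b1 thb n0 bM QI; have nR : 1 <= n%:R :> R by rewrite ler1n.
have n0R : 0 < n%:R :> R by rewrite ltr0n.
apply: (le_trans (hpois_tail_le QI _)).
have F0 : 0 < (3 * M)`!%:R :> R by rewrite ltr0n fact_gt0.
rewrite ler_pdivrMr// mulrC ler_pdivlMr ?exprn_gt0//.
have cube : M`!%:R ^+ 3 <= (3 * M)`!%:R :> R.
  rewrite -natrX ler_nat (_ : 3 * M = M + (M + M))%N; last by rewrite 2!mulSn mul1n.
  rewrite expnS expnS expn1 (leq_trans _ (leq_fact_mul _ _))//.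
  by rewrite leq_mul2l leq_fact_mul orbT.
apply: (le_trans _ cube).
have b0 : 0 <= b by exact: le_trans b1.
apply: (@le_trans _ _ ((b ^+ M * n%:R) ^+ 3)); last first.
  by apply: lerXn2r; rewrite // nnegrE ?ler0n// mulr_ge0 ?exprn_ge0.
rewrite exprMn -exprM mulnC; apply: ler_pM; rewrite ?exprn_ge0 ?(ltW th_gt0)//.
  by apply: lerXn2r; rewrite // nnegrE ltW.
by rewrite ler_weXn2l.
Qed.

Lemma kernel_level_le (b : R) (n M : nat) :
  B ^+ 2 <= b -> (0 < n)%N -> b ^+ M * n%:R <= M`!%:R ->
  B ^+ M / Num.sqrt M`!%:R <= (Num.sqrt n%:R)^-1.
Proof.
move=> Bb n0 bM.
have n0R : 0 < n%:R :> R by rewrite ltr0n.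
have F0 : 0 < M`!%:R :> R by rewrite ltr0n fact_gt0.
rewrite ler_pdivrMr ?sqrtr_gt0// mulrC ler_pdivlMr ?sqrtr_gt0//.
rewrite -[B ^+ M]ger0_norm ?exprn_ge0// -sqrtr_sqr -sqrtrM ?sqr_ge0//.
rewrite ler_wsqrtr// (le_trans _ bM)// ler_wpM2r ?ler0n//.
rewrite -exprM mulnC exprM; apply: lerXn2r; rewrite // nnegrE ?sqr_ge0//.
by rewrite (le_trans _ Bb) ?sqr_ge0.
Qed.

(** The square of [2 sqrt th / s] is [4 * th / s ^ 2], so [rr <= expR (lam / 2)]. As
    [3 * M <= 12 * L / l], the exponent is at most [6 * lam * L / l], within the claimed
    [8 * lam * L / l]. *)
Lemma ratio_pow_le (L l : R) (M : nat) : 0 <= L -> 0 < l -> M%:R <= 4 * L / l ->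
  s ^+ 2 < 4 * th -> rr ^+ (3 * M) <= expR (8 * ln (4 * th / s ^+ 2) / l * L).
Proof.
move=> L0 l0 ML sth.
have s20 : 0 < s ^+ 2 by rewrite exprn_gt0.
set lam := ln _.
have r1 : 1 <= 4 * th / s ^+ 2 by rewrite ler_pdivlMr// mul1r ltW.
have lam0 : 0 <= lam by exact: ln_ge0.
have rle : rr <= expR (lam / 2).
  rewrite ge_max; apply/andP; split.
    by rewrite -[leLHS]expR0 ler_expR divr_ge0.
  have rt0 : 0 <= 2 * Num.sqrt th / s by rewrite divr_ge0 ?mulr_ge0 ?sqrtr_ge0 ?(ltW s_gt0).
  rewrite -ler_sqr ?nnegrE ?expR_ge0// -expRM_natl.
  rewrite (_ : 2%:R * (lam / 2) = lam); last by field.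
  rewrite lnK ?posrE ?(lt_le_trans ltr01)// expr_div_n [(2 * _) ^+ 2]exprMn sqr_sqrtr ?(ltW th_gt0)//.
  by rewrite (_ : 2 ^+ 2 = 4 :> R)//; ring.
apply: (@le_trans _ _ (expR (lam / 2) ^+ (3 * M))).
  by apply: lerXn2r; rewrite // nnegrE ?expR_ge0// (le_trans ler01).
rewrite -expRM_natl ler_expR natrM.
apply: (@le_trans _ _ (3 * (4 * L / l) * (lam / 2))).
  by rewrite ler_wpM2r ?divr_ge0// ler_wpM2l.
rewrite -subr_ge0 (_ : _ - _ = 2 * lam * L / l); last by field; rewrite gt_eqF.
by rewrite divr_ge0 ?(ltW l0)// !mulr_ge0.
Qed.

Lemma ratio_eq1 : 4 * th <= s ^+ 2 -> rr = 1.
Proof.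
move=> ths; apply/eqP; rewrite eq_le rr1 andbT ge_max lexx/=.
rewrite ler_pdivrMr// mul1r -ler_sqr ?nnegrE ?(ltW s_gt0) ?mulr_ge0 ?sqrtr_ge0//.
by rewrite exprMn sqr_sqrtr ?(ltW th_gt0)// (_ : 2 ^+ 2 = 4 :> R)//; ring.
Qed.

End risk_bound.

Unset Implicit Arguments.

Theorem theorem1 (R : realType) (th s : R) (th_gt0 : 0 < th) (s_gt0 : 0 < s)
    (Qhat : forall n, ('I_n -> nat) -> probability R R) :
  is_NPMLE th Qhat ->
  let c := 8 * ln (4 * th / s ^+ 2) in
  exists (a C : R) (N : nat), 0 < a /\
    forall n : nat, (N <= n)%N ->
    forall Q : probability R R, supported_on th Q ->
      (risk th s Qhat n Q <=
        (C * (if s ^+ 2 < 4 * th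
              then n%:R `^ (- (1/2) + c / ln (ln n%:R))
              else n%:R `^ (- (1/2))) * (ln n%:R) `^ a)%:E)%E.
Proof.
move=> MLE c.
pose B := 2 * (th / s) + (th / s) ^+ 2.
pose rr := Num.max 1 (2 * Num.sqrt th / s).
pose E0 := 4 * expR (3 * (th / s) ^+ 2).
pose C := smoothing_cst s.
(* One base that is at least 1, [th] and [B ^ 2], as the choice of level, the Poisson tail and the
   kernel remainder require. *)
pose b := 1 + B ^+ 2 + th.
have C0 : 0 <= C by exact: smoothing_cst_ge0.
have E00 : 0 <= E0 by rewrite mulr_ge0 ?expR_ge0.
have b1 : 1 <= b by rewrite /b -addrA lerDl addr_ge0 ?sqr_ge0 ?(ltW th_gt0).
have bth : th <= b by rewrite /b lerDr addr_ge0 ?sqr_ge0.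
have bB : B ^+ 2 <= b by rewrite /b; move: (sqr_ge0 B) th_gt0; lra.
have [N HN] := trunc_level_spec b1.
(* The power 3 stems from [M ^ 3]: [M ^ 2] expansion terms times the number of cells, proportional
   to [M]. The factor [64 = 4 ^ 3] comes from [M <= 4 * ln n]. *)
exists 3, (64 * C * (21 + 2 * E0)), N; split=> // n /HN[n1 l1 M0 ML bM] Q QI.
have n0 : (0 < n)%N by rewrite -(ltr0n R) (lt_trans ltr01).
move: (trunc_level n) M0 ML bM => M M0 ML bM.
have n0R : 0 < n%:R :> R by rewrite ltr0n.
have L0 : 0 < ln n%:R :> R by rewrite ln_gt0.
have l0 : 0 < ln (ln n%:R) :> R by exact: lt_le_trans l1.
apply: (le_trans (risk_le th_gt0 s_gt0 MLE n0 M0 QI (tail_level_le th_gt0 b1 bth n0 bM QI)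
  (kernel_level_le th_gt0 s_gt0 bB n0 bM))).
rewrite lee_fin -/C -/E0 -/rr.
have M4 : M%:R <= 4 * ln n%:R :> R.
  by rewrite (le_trans ML)// ler_pdivrMr// ler_peMr// mulr_ge0// ltW.
have M43 : M%:R ^+ 3 <= 64 * ln n%:R ^+ 3 :> R.
  rewrite (_ : 64 * ln n%:R ^+ 3 = (4 * ln n%:R) ^+ 3); last by ring.
  by apply: lerXn2r; rewrite // nnegrE ?ler0n// mulr_ge0 ?(ltW L0).
have half : n%:R `^ (- (1/2)) = (Num.sqrt n%:R)^-1 :> R by rewrite powRN div1r powR12_sqrt ?ler0n.
have CE : 0 <= C * (21 + 2 * E0) by rewrite mulr_ge0// addr_ge0// mulr_ge0.
have rate : rr ^+ (3 * M) * (Num.sqrt n%:R)^-1 <=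
    if s ^+ 2 < 4 * th then n%:R `^ (- (1/2) + c / ln (ln n%:R)) else n%:R `^ (- (1/2)).
  case: ltP => sth; last by rewrite /rr ratio_eq1// expr1n mul1r half.
  rewrite powRD; last by apply/implyP => _; rewrite gt_eqF.
  rewrite half mulrC ler_wpM2l ?invr_ge0 ?sqrtr_ge0//.
  by rewrite /powR gt_eqF//; exact: (ratio_pow_le th_gt0 s_gt0 (ltW L0) l0 ML sth).
rewrite -[leLHS]mulrA.
set rt := (if _ then _ else _) in rate *.
have rq0 : 0 <= rr ^+ (3 * M) * (Num.sqrt n%:R)^-1.
  by rewrite mulr_ge0 ?invr_ge0 ?sqrtr_ge0// exprn_ge0// le_max ler01.
rewrite (_ : ln n%:R `^ 3 = ln n%:R ^+ 3); last by rewrite -powR_mulrn ?(ltW L0).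
rewrite [leRHS](_ : _ = C * (21 + 2 * E0) * (64 * ln n%:R ^+ 3) * rt); last by ring.
apply: ler_pM => //; first by rewrite mulr_ge0 ?exprn_ge0 ?ler0n.
by rewrite ler_wpM2l.
Qed.
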